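(* Let $0<q<p<\infty$, $1<p<\infty$, and let $u,v$ be weights on $\mathbb{R}^n$. Suppose that $v\in A_1$. Then the weighted inequality $$\|Mf\|_{L^q(u)}\le C\|f\|_{L^p(v^{1-p})}$$ holds for every $f\in L^p(\mathbb{R}^n,v^{1-p})$, with a constant $C>0$ independent of $f$, if and only if $$\|u^{1/q}v^{1/p'}\|_{L^r}<\infty,\qquad\text{where } \frac1q=\frac1r+\frac1p.$$
   Context: A weight is a non-negative, locally integrable function on $\mathbb{R}^n$ that is positive on a set of positive measure. For $1<p<\infty$, $p'=p/(p-1)$. $\mathcal{Q}$ is the family of all cubes in $\mathbb{R}^n$ with sides parallel to the coordinate axes, $|Q|$ is the volume of $Q$, and $1_Q$ its characteristic function. Hardy-Littlewood maximal operator: $Mf(x)=\sup_{Q\in\mathcal{Q}}\left(\frac{1}{|Q|}\int_Q|f(y)|\,dy\right)1_Q(x)$. A weight $w$ belongs to the Muckenhoupt class $A_1$ if $[w]_{A_1}=\sup_{x\in\mathbb{R}^n}\frac{Mw(x)}{w(x)}<\infty$. For $0<s<\infty$ and a non-negative measurable function $w$, $\|f\|_{L^s(w)}=\left(\int_{\mathbb{R}^n}|f(x)|^s w(x)\,dx\right)^{1/s}$, and $L^s(\mathbb{R}^n,w)$ is the set of measurable $f$ with $\|f\|_{L^s(w)}<\infty$; $\|f\|_{L^r}=\left(\int_{\mathbb{R}^n}|f(x)|^r\,dx\right)^{1/r}$ (a quasi-norm if $r<1$). *)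

(* Defs.v *)
From HB Require Import structures.
From mathcomp Require Import all_boot all_order all_algebra.
From mathcomp Require Import all_classical all_reals all_analysis.
From mathcomp Require Import ess_sup_inf.

Set Implicit Arguments.
Unset Strict Implicit.
Unset Printing Implicit Defensive.

Import Order.TTheory GRing.Theory Num.Theory.
Import numFieldNormedType.Exports.

Local Open Scope classical_set_scope.
Local Open Scope ring_scope.
Local Open Scope ereal_scope.

(* R^n is 'rV[R]_n.+1 throughout, so that the dimension n.+1 is at least 1.
   MathComp-Analysis has Lebesgue measure only on the line. Lebesgue measure on
   R^n is obtained here from the usual outer measure (countable covers by
   half-open boxes), with the library's Caratheodory construction providing the
   sigma-algebra of Lebesgue measurable sets and the measure on it. *)

Definition box (R : realType) (n : nat) (B : 'rV[R]_n.+1 * 'rV[R]_n.+1) :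
    set 'rV[R]_n.+1 :=
  [set x | forall i, (B.1 ord0 i < x ord0 i <= B.2 ord0 i)%R].

(* The truncation at 0 gives volume 0 to the empty boxes. *)
Definition box_volume (R : realType) (n : nat)
    (B : 'rV[R]_n.+1 * 'rV[R]_n.+1) : R :=
  (\prod_(i < n.+1) Num.max 0 (B.2 ord0 i - B.1 ord0 i))%R.

Definition leb_outer (R : realType) (n : nat) (E : set 'rV[R]_n.+1) : \bar R :=
  ereal_inf [set \sum_(k <oo) (box_volume (B k))%:E |
             B in [set B : nat -> 'rV[R]_n.+1 * 'rV[R]_n.+1 |
                   E `<=` \bigcup_k box (B k)]].

Lemma box_volume_ge0 (R : realType) (n : nat)
    (B : 'rV[R]_n.+1 * 'rV[R]_n.+1) : 0 <= (box_volume B)%:E.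
Proof. by rewrite lee_fin prodr_ge0// => i _; rewrite le_max lexx. Qed.

Lemma leb_outer_ge0 (R : realType) (n : nat) (E : set 'rV[R]_n.+1) :
  0 <= leb_outer E.
Proof.
apply: le_ereal_inf_tmp => _ [B _ <-].
by apply: nneseries_ge0 => k _ _; exact: box_volume_ge0.
Qed.

Lemma leb_outer0 (R : realType) (n : nat) :
  leb_outer (set0 : set 'rV[R]_n.+1) = 0.
Proof.
apply/eqP; rewrite eq_le leb_outer_ge0 andbT.
apply: ereal_inf_lbound; exists (fun=> (0, 0)%R) => //=.
apply: eseries0 => k _ _.
by rewrite /box_volume big_ord_recl /= mxE subrr maxxx mul0r.
Qed.

Lemma le_leb_outer (R : realType) (n : nat) :
  {homo @leb_outer R n : A B / A `<=` B >-> A <= B}.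
Proof.
move=> A B AB; apply: ereal_inf_le_tmp => x [C BC <-].
by exists C => //; exact: subset_trans AB BC.
Qed.

Lemma leb_outer_sigma_subadditive (R : realType) (n : nat) :
  sigma_subadditive (@leb_outer R n).
Proof.
move=> A; have [[i ioo]|] := pselect (exists i, leb_outer (A i) = +oo).
  rewrite (eseries_pinfty _ _ ioo) ?leey// => k _.
  by rewrite -ltNye (lt_le_trans _ (leb_outer_ge0 _)).
rewrite -forallNE => Aoo.
suff add2e (e : {posnum R}) :
    leb_outer (\bigcup_n A n) <= \sum_(i <oo) leb_outer (A i) + e%:num%:E.
  by apply/lee_addgt0Pr => _/posnumP[].
rewrite (le_trans _ (epsilon_trick _ _ _))//; last first.
  by move=> k; exact: leb_outer_ge0.
pose vol (B : 'rV[R]_n.+1 * 'rV[R]_n.+1) := (box_volume B)%:E.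
pose P k (B : nat -> 'rV[R]_n.+1 * 'rV[R]_n.+1) :=
  A k `<=` \bigcup_j box (B j) /\
  \sum_(j <oo) vol (B j) <= leb_outer (A k) + (e%:num / (2 ^ k.+1)%:R)%:E.
have [G PG] :
    {G : nat -> nat -> 'rV[R]_n.+1 * 'rV[R]_n.+1 & forall k, P k (G k)}.
  apply: (@choice _ _ P) => k; rewrite /P /leb_outer.
  set S := (X in ereal_inf X); move infS : (ereal_inf S) => iS.
  case: iS infS => [r Sr|Soo|Soo].
  - have en1 : (0 < e%:num / (2 ^ k.+1)%:R)%R by [].
    have /(lb_ereal_inf_adherent en1) : ereal_inf S \is a fin_num by rewrite Sr.
    move=> [x [B AnB muBx] xS].
    by exists B; split => //; rewrite /vol muBx -Sr; exact/ltW.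
  - by have := Aoo k; rewrite /leb_outer Soo.
  - by have := leb_outer_ge0 (A k); rewrite /leb_outer Soo.
have vol_ge0 x : 0 <= (vol \o uncurry G) x by exact: box_volume_ge0.
apply: (@le_trans _ _ (\esum_(i in setT) (vol \o uncurry G) i)).
  rewrite /leb_outer; apply: ereal_inf_lbound => /=.
  have /card_esym/ppcard_eqP[f] := card_nat2.
  exists (uncurry G \o f).
    apply: (@subset_trans _ (\bigcup_k \bigcup_j box (G k j))) => [t [i _]|].
      by move=> /(PG i).1 -[j _ ?]; exists i => //; exists j.
    move=> t [i _ [j _ Bijt]]; exists (f^-1%FUN (i, j)) => //=.
    by rewrite invK ?inE.
  rewrite -(esum_pred_image (vol \o uncurry G) _ xpredT) ?[fun=> _]set_true//.
  by rewrite image_eq.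
rewrite (_ : esum _ _ = \sum_(i <oo) \sum_(j <oo) vol (G i j)); last first.
  pose J : nat -> set (nat * nat) := fun i => [set (i, j) | j in setT].
  rewrite (_ : setT = \bigcup_k J k); last first.
    by rewrite predeqE => -[a b]; split => // _; exists a => //; exists b.
  rewrite esum_bigcupT /=; last 2 first.
    - apply/trivIsetP => i j _ _ ij.
      rewrite predeqE => -[k m] /=; split => //= -[] [_] _ [<-{k} _].
      by move=> [m' _] [] /esym/eqP; rewrite (negbTE ij).
    - by move=> /= [k m] *; exact: (vol_ge0 (k, m)).
  rewrite -(image_id [set: nat]) -fun_true esum_pred_image//; last first.
    by move=> k _; apply: esum_ge0 => m _; exact: vol_ge0.
  apply: eq_eseriesr => /= j _.
  rewrite -(esum_pred_image (vol \o uncurry G) (pair j) predT)//=; last 2 first.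
  - by move=> m _; exact: (vol_ge0 (j, m)).
  - by move=> ? ? _ _; exact: (@can_inj _ _ _ snd).
  by congr esum; rewrite predeqE => -[a b]; split; move=> [i _ <-]; exists i.
apply: lee_lim.
- apply: is_cvg_nneseries => k *.
  by apply: nneseries_ge0 => m *; exact: (vol_ge0 (k, m)).
- by apply: is_cvg_nneseries => k *; apply: adde_ge0 => //; exact: leb_outer_ge0.
- by near=> k; apply: lee_sum => i _; exact: (PG i).2.
Unshelve. all: by end_near. Qed.

HB.instance Definition _ (R : realType) (n : nat) :=
  isOuterMeasure.Build R 'rV[R]_n.+1 (@leb_outer R n)
    (@leb_outer0 R n) (@leb_outer_ge0 R n)
    (@le_leb_outer R n) (@leb_outer_sigma_subadditive R n).

(* A copy of 'rV[R]_n.+1 whose measurable sets are the Lebesgue measurable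
   ones. *)
Notation Rn R n := (caratheodory_type (@leb_outer R n)).

Definition leb (R : realType) (n : nat) : set (Rn R n) -> \bar R :=
  @leb_outer R n.
HB.instance Definition _ (R : realType) (n : nat) :=
  isMeasure.Build _ _ _ (@leb R n)
    (caratheodory_measure0 _) (@caratheodory_measure_ge0 _ _ (@leb_outer R n))
    (@caratheodory_measure_sigma_additive _ _ (@leb_outer R n)).

Definition weight (R : realType) (n : nat) (w : Rn R n -> R) : Prop :=
  [/\ measurable_fun [set: Rn R n] w,
      forall x, (0 <= w x)%R,
      forall K : set 'rV[R]_n.+1, compact K ->
        \int[@leb R n]_(x in K) `|w x|%:E < +oo
    & 0 < @leb R n [set x | (0 < w x)%R]].

(* Whether cubes are taken open or closed does not change the maximal
   function. *)
Definition cube (R : realType) (n : nat) (a : 'rV[R]_n.+1) (l : R) :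
    set 'rV[R]_n.+1 :=
  [set x | forall i, (a ord0 i < x ord0 i < a ord0 i + l)%R].

Definition cubes (R : realType) (n : nat) : set (set 'rV[R]_n.+1) :=
  [set Q | exists a, exists2 l : R, (0 < l)%R & Q = cube a l].

Definition average (R : realType) (n : nat) (f : Rn R n -> R)
    (Q : set 'rV[R]_n.+1) : \bar R :=
  (@leb R n Q)^-1 * \int[@leb R n]_(y in Q) `|f y|%:E.

Definition maximal (R : realType) (n : nat) (f : Rn R n -> R) (x : Rn R n) :
    \bar R :=
  ereal_sup [set average f Q * (\1_Q x)%:E | Q in @cubes R n].

(* Weights are real-valued functions considered up to null sets, hence the
   essential supremum: with the supremum over every single point, |x|^(-a) with
   0 < a < n would not be an A_1 weight, its maximal function being infinite at
   the origin whatever real value it is given there. In \bar R, r / 0 = +oo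
   for r > 0. *)
Definition A1_constant (R : realType) (n : nat) (w : Rn R n -> R) : \bar R :=
  ess_sup (@leb R n) (fun x => maximal w x / (w x)%:E).

Definition A1 (R : realType) (n : nat) (w : Rn R n -> R) : Prop :=
  weight w /\ A1_constant w < +oo.

(* The values of F may be infinite, as those of a maximal function. *)
Definition wnorm (R : realType) (n : nat) (s : R) (w : Rn R n -> R)
    (F : Rn R n -> \bar R) : \bar R :=
  (\int[@leb R n]_x (`|F x| `^ s * (w x)%:E)) `^ s^-1.

Definition wLspace (R : realType) (n : nat) (s : R) (w : Rn R n -> R) :
    set (Rn R n -> R) :=
  [set f | measurable_fun [set: Rn R n] f /\ wnorm s w (EFin \o f) < +oo].

(* Main.v *)
(* For almost every x, averages over a cube Q containing x satisfy
     |Q|^-1 \int_Q |f| <= [v]_A1 v(x) v(Q)^-1 \int_Q (|f| / v) v,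
   so Mf <= C v M_v(|f| / v) with M_v the maximal operator of the measure v dx.
   The A_1 condition makes v dx doubling, hence M_v is of weak type (1,1) by
   Vitali's covering lemma and bounded on L^p(v) by summation over dyadic
   levels. This gives ||Mf||_{L^p(v^(1-p))} <= C ||f||_{L^p(v^(1-p))}, and
   Hoelder's inequality with exponents p/q and r/q yields one implication.
   Conversely |f| <= C Mf almost everywhere, and the resulting inequality
   ||f||_{L^q(u)} <= C ||f||_{L^p(v^(1-p))} is tested on truncations of
   (u v^(p-1))^(1/(p-q)). That |f| <= C Mf needs no differentiation theorem: for
   small c, the set where |f| >= t but Mf <= ct fills at most half of any box. *)
Require Import Defs.
From mathcomp Require Import all_boot all_order all_algebra.
From mathcomp Require Import all_classical all_reals all_analysis.
From mathcomp Require Import measurable_realfun ess_sup_inf ring lra.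

Set Implicit Arguments.
Unset Strict Implicit.
Unset Printing Implicit Defensive.

Import Order.TTheory GRing.Theory Num.Theory.
Import numFieldNormedType.Exports.

Local Open Scope classical_set_scope.
Local Open Scope ring_scope.
Local Open Scope ereal_scope.

(** [maximal f] is a supremum over uncountably many cubes, and its measurability is not established.
    What shapes the proof is that the integral of a nonnegative function is the supremum of the
    integrals of the simple functions below it, hence monotone for arbitrary integrands. So
    [maximal f] is only compared with measurable functions: almost everywhere it lies below a
    multiple of [v x * F x], where [F] is the maximal function of the countable family of rational
    cubes, and above a multiple of |f|. Constants are pulled out of integrals of measurable
    functions only. Every cube lies in a rational one of at most twice its side, so passing to a
    countable family costs a constant factor. Volumes of cubes enter through scaling, an upper bound
    and positivity, the last being extracted from the set where a weight is positive. *)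

Lemma ge0_le_integral_nonmeasurable d (T : measurableType d) (R : realType)
    (mu : {measure set T -> \bar R}) (D : set T) (f g : T -> \bar R) :
  (forall x, D x -> 0 <= f x) -> (forall x, D x -> f x <= g x) ->
  \int[mu]_(x in D) f x <= \int[mu]_(x in D) g x.
Proof.
move=> f0 fg; have g0 x : D x -> 0 <= g x.
  by move=> Dx; apply: le_trans (fg x Dx); exact: f0.
rewrite !ge0_integralE//; apply: ge_ereal_sup => _ /= [h hf <-].
apply: ereal_sup_ubound; exists h => //= x.
by apply: le_trans (hf x) _; exact: lee_restrict.
Qed.

(** * Lebesgue outer measure of boxes and cubes *)

Section lebesgue_outer_measure.
Context (R : realType) (n : nat).
Implicit Types (E : set 'rV[R]_n.+1) (a : 'rV[R]_n.+1) (l : R).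

Lemma leb_outer_le E (B : nat -> 'rV[R]_n.+1 * 'rV[R]_n.+1) :
  E `<=` \bigcup_k box (B k) ->
  leb_outer E <= \sum_(k <oo) (box_volume (B k))%:E.
Proof. by move=> EB; apply: ereal_inf_lbound; exists B. Qed.

Lemma leb_outer_ge E (M : \bar R) :
  (forall B : nat -> 'rV[R]_n.+1 * 'rV[R]_n.+1, E `<=` \bigcup_k box (B k) ->
    M <= \sum_(k <oo) (box_volume (B k))%:E) ->
  M <= leb_outer E.
Proof. by move=> h; apply: le_ereal_inf_tmp => _ [B EB <-]; exact: h. Qed.

Lemma leb_outer_box (B : 'rV[R]_n.+1 * 'rV[R]_n.+1) :
  leb_outer (box B) <= (box_volume B)%:E.
Proof.
pose C (k : nat) : 'rV[R]_n.+1 * 'rV[R]_n.+1 :=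
  if k is 0%N then B else (0, 0)%R.
have BC : box B `<=` \bigcup_k box (C k) by move=> x Bx; exists 0%N.
apply: le_trans (leb_outer_le BC) _.
rewrite nneseries_recl//; last by move=> *; exact: box_volume_ge0.
rewrite -[leRHS]adde0 leeD2l// eseries_cond eseries0// => -[//|k] _ _ /=.
by rewrite /box_volume big_ord_recl /= mxE subrr maxxx mul0r.
Qed.

Lemma box_volume_affine a l (B : 'rV[R]_n.+1 * 'rV[R]_n.+1) : (0 < l)%R ->
  box_volume (a + l *: B.1, a + l *: B.2)%R = (l ^+ n.+1 * box_volume B)%R.
Proof.
move=> l0.
have -> : (l ^+ n.+1 = \prod_(i < n.+1) l)%R by rewrite prodr_const card_ord.
rewrite /box_volume -big_split /=.
apply: eq_bigr => i _; rewrite !mxE opprD addrACA subrr add0r -mulrBr.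
by rewrite maxr_pMr ?mulr0// ltW.
Qed.

Lemma leb_outer_affine_le a l E : (0 < l)%R ->
  leb_outer [set a + l *: x | x in E]%R <= (l ^+ n.+1)%:E * leb_outer E.
Proof.
move=> l0; have l'0 : (0 < l ^+ n.+1)%R by rewrite exprn_gt0.
rewrite -lee_pdivrMl//; apply: leb_outer_ge => B EB.
rewrite lee_pdivrMl// -nneseriesZl//; last by move=> *; exact: box_volume_ge0.
pose C k := (a + l *: (B k).1, a + l *: (B k).2)%R.
have EC : [set a + l *: x | x in E]%R `<=` \bigcup_k box (C k).
  move=> _ [x /EB [k _ Bx] <-]; exists k => // i.
  by rewrite !mxE ltrD2l lerD2l ltr_pM2l// ler_pM2l.
apply: le_trans (leb_outer_le EC) _.
by under eq_eseriesr do rewrite box_volume_affine// EFinM.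
Qed.

Lemma cube_affine a b l m : (0 < l)%R ->
  [set b + l *: x | x in cube a m]%R = cube (b + l *: a)%R (l * m)%R.
Proof.
move=> l0; apply/seteqP; split=> [_ [x x01 <-] i|x ax].
  by rewrite !mxE; have := x01 i; nra.
exists (l^-1 *: (x - b))%R; last first.
  by rewrite scalerA divff ?gt_eqF// scale1r addrC subrK.
move=> i; rewrite !mxE; have := ax i; rewrite !mxE => /andP[h1 h2].
by rewrite ltr_pdivlMl// ltr_pdivrMl//; apply/andP; split; lra.
Qed.

(** The two inequalities are [leb_outer_affine_le] for the affine map that carries the unit cube to
    the given one, and for its inverse. *)
Lemma leb_cube a l : (0 < l)%R ->
  @leb R n (cube a l) = (l ^+ n.+1)%:E * @leb R n (cube 0 1).
Proof.
move=> l0; apply/eqP; rewrite eq_le; apply/andP; split.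
  have -> : cube a l = [set a + l *: x | x in cube 0 1]%R.
    by rewrite cube_affine// scaler0 addr0 mulr1.
  exact: leb_outer_affine_le.
rewrite -lee_pdivlMl ?exprn_gt0// -exprVn.
have -> : cube 0 1 = [set - (l^-1 *: a) + l^-1 *: x | x in cube a l]%R.
  by rewrite cube_affine ?invr_gt0// addNr mulVf ?gt_eqF.
by apply: leb_outer_affine_le; rewrite invr_gt0.
Qed.

Lemma leb_cube_le a l : (0 < l)%R -> @leb R n (cube a l) <= (l ^+ n.+1)%:E.
Proof.
move=> l0; pose B : 'rV[R]_n.+1 * 'rV[R]_n.+1 := (a, a + const_mx l)%R.
have aB : cube a l `<=` box B.
  by move=> x ax i; rewrite !mxE; have := ax i => /andP[-> /ltW ->].
apply: le_trans (le_leb_outer aB) _; apply: le_trans (leb_outer_box _) _.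
have -> : (l ^+ n.+1 = \prod_(i < n.+1) l)%R by rewrite prodr_const card_ord.
rewrite lee_fin /box_volume /B/=.
rewrite le_eqVlt; apply/orP; left; apply/eqP; apply: eq_bigr => i _.
by rewrite !mxE addrAC subrr add0r (max_idPr _)// ltW.
Qed.

(** All coordinates lie in the open interval from - k to k + 2, so the common centre is the point
    with all coordinates 1. *)
Definition centered_cube (k : nat) : set 'rV[R]_n.+1 :=
  cube (const_mx (- k%:R)%R) (2 * k.+1%:R).

Lemma centered_cube_sub i j : (i <= j)%N ->
  centered_cube i `<=` centered_cube j.
Proof.
move=> ij x xi m; have := xi m; rewrite !mxE => /andP[h1 h2].
have : (i%:R <= j%:R :> R)%R by rewrite ler_nat.
by rewrite -!natr1 in h2 *; move=> ijR; apply/andP; split; lra.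
Qed.

Lemma bigcup_centered_cube : \bigcup_k centered_cube k = setT.
Proof.
apply/seteqP; split=> // x _; pose M := (\sum_i `|x ord0 i|)%R.
exists (Num.truncn (M + 1)%R) => // i; rewrite !mxE.
have M0 : (0 <= M)%R by apply: sumr_ge0.
have xM : (`|x ord0 i| <= M)%R by rewrite /M (bigD1 i)//= lerDl sumr_ge0.
have := truncnS_gt (M + 1)%R; rewrite -natr1.
by move: xM; rewrite ler_norml => /andP[]; lra.
Qed.

(* Stands in for the lower bound of the measure of a box: a set of nonzero
   measure is covered by dilates of the unit cube. *)
Lemma cube_unit_gt0 E : @leb R n E != 0 -> 0 < @leb R n (cube 0 1).
Proof.
move=> E0; rewrite lt0e leb_outer_ge0 andbT; apply: contra_neq E0 => c0.
apply/eqP; rewrite eq_le leb_outer_ge0 andbT.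
apply: le_trans (le_leb_outer (@subsetT _ E)) _.
rewrite -bigcup_centered_cube.
apply: le_trans (leb_outer_sigma_subadditive centered_cube) _.
rewrite eseries0// => k _ _; apply: etrans (leb_cube _ _) _.
  by rewrite mulr_gt0.
by rewrite c0 mule0.
Qed.

End lebesgue_outer_measure.
Arguments centered_cube : clear implicits.

(** * Measurability of cubes *)

Section coordinates.
Context (R : realType) (n : nat).
Implicit Types (a : 'rV[R]_n.+1) (l : R) (i : 'I_n.+1).

(** The hyperplane x_i = c may miss the box: one piece is then empty, and the truncation at 0 in the
    volume makes it count for nothing. *)
Lemma box_volume_cut (B : 'rV[R]_n.+1 * 'rV[R]_n.+1) i (c : R) :
  box_volume B =
    (box_volume (B.1, \row_j if j == i then Num.min (B.2 ord0 j) c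
                             else B.2 ord0 j) +
     box_volume (\row_j (if j == i then Num.max (B.1 ord0 j) c
                         else B.1 ord0 j), B.2))%R.
Proof.
rewrite /box_volume (bigD1 i)//= [X in (_ = X + _)%R](bigD1 i)//=.
rewrite [X in (_ = _ + X)%R](bigD1 i)//= !mxE !eqxx.
set P := (X in (_ * X = _)%R); set P1 := (X in (_ = _ * X + _)%R).
set P2 := (X in (_ = _ + _ * X)%R).
have -> : P1 = P by apply: eq_bigr => j /negPf ji; rewrite !mxE ji.
have -> : P2 = P by apply: eq_bigr => j /negPf ji; rewrite !mxE ji.
rewrite -mulrDl; congr (_ * _)%R.
by rewrite /Num.max /Num.min; do ![case: ifPn]; lra.
Qed.

(** Caratheodory's criterion: the hyperplane cuts every box of a cover of [X] into two boxes, again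
    half-open. One family covers the part of [X] in the half-space, the other the rest, and the
    total volume is unchanged. *)
Lemma measurable_halfspace i (c : R) :
  measurable [set x : Rn R n | (x ord0 i <= c)%R].
Proof.
set H := [set x | _]; apply: le_caratheodory_measurable => X.
apply: leb_outer_ge => B XB.
pose B1 k := ((B k).1, \row_j if j == i then Num.min ((B k).2 ord0 j) c
                             else (B k).2 ord0 j)%R.
pose B2 k := (\row_j (if j == i then Num.max ((B k).1 ord0 j) c
                         else (B k).1 ord0 j), (B k).2)%R.
under eq_eseriesr do rewrite (box_volume_cut _ i c) EFinD.
rewrite nneseriesD; [|by move=> *; exact: box_volume_ge0..].
rewrite leeD//.
  apply: (@leb_outer_le _ _ _ B1) => x [/XB[k _ Bx]]; rewrite /H/= => Hx;
    exists k => // j.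
  rewrite /B1 /= !mxE; have /andP[-> h] /= := Bx j.
  case: eqVneq => // ->; rewrite le_min; apply/andP; split=> //.
  by have /andP[] := Bx i.
apply: (@leb_outer_le _ _ _ B2) => x [/XB[k _ Bx] /negP]; rewrite -ltNge => Hx.
exists k => // j.
rewrite /B2 /= !mxE; have /andP[h ->] /= := Bx j; rewrite andbT.
case: eqVneq => // ->; rewrite gt_max; apply/andP; split=> //.
by have /andP[] := Bx i.
Qed.

Lemma measurable_coord i : measurable_fun [set: Rn R n] (fun x => x ord0 i).
Proof.
apply: (measurability _ (RGenOInfty.measurableE R)) => //.
move=> _ [_ [c ->] <-]; rewrite setTI.
rewrite (_ : _ @^-1` _ = ~` [set x : Rn R n | (x ord0 i <= c)%R]).
  exact/measurableC/measurable_halfspace.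
by apply/seteqP; split=> x /=; rewrite in_itv/= andbT ltNge => /negP.
Qed.

Lemma measurable_cube a l : measurable (cube a l : set (Rn R n)).
Proof.
rewrite (_ : cube a l = \bigcap_(i in [set: 'I_n.+1])
    [set x : Rn R n | (a ord0 i < x ord0 i < a ord0 i + l)%R]).
  apply: fin_bigcap_measurable => [|i _]; first exact: finite_finset.
  have := @measurable_coord i measurableT _
    (measurable_itv `]a ord0 i, (a ord0 i + l)%R[).
  rewrite setTI /preimage /=.
  by under eq_set do rewrite in_itv.
by apply/seteqP; split=> x; [move=> ax i _; exact: ax|move=> ax i; exact: ax].
Qed.

Lemma compact_closed_cube a l :
  compact [set x : 'rV[R]_n.+1 |
    forall i, (a ord0 i <= x ord0 i <= a ord0 i + l)%R].
Proof.
have := @rV_compact R n.+1 (fun i => `[a ord0 i, (a ord0 i + l)%R]%classic).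
move=> /(_ (fun i => @segment_compact _ _ _)) /=.
by under eq_set do under eq_forall do rewrite in_itv.
Qed.

End coordinates.

(** * The maximal function dominates the function *)

Lemma negligible_leb_outer (R : realType) (n : nat) (E : set (Rn R n)) :
  leb_outer E = 0 -> (@leb R n).-negligible E.
Proof.
move=> E0; exists E; split=> //; apply: le_caratheodory_measurable => X.
have h1 : leb_outer (X `&` E) <= 0.
  by rewrite -E0; apply: le_leb_outer; exact: subIsetr.
have h2 : leb_outer (X `&` ~` E) <= leb_outer X.
  by apply: le_leb_outer; exact: subIsetl.
by rewrite -[leRHS]add0e; exact: leeD h1 h2.
Qed.

Section density.
Context (R : realType) (n : nat) (f : Rn R n -> R).
Hypothesis mf : measurable_fun [set: Rn R n] f.
Hypothesis c0 : 0 < @leb R n (cube 0 1).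
Implicit Types (a : 'rV[R]_n.+1) (l t : R) (x : Rn R n).

Lemma leb_cube_gt0 a l : (0 < l)%R -> 0 < @leb R n (cube a l).
Proof. by move=> l0; rewrite leb_cube// mule_gt0// lte_fin exprn_gt0. Qed.

Lemma leb_cube_fin_num a l : (0 < l)%R -> @leb R n (cube a l) \is a fin_num.
Proof.
move=> l0; rewrite ge0_fin_numE ?measure_ge0//.
by apply: le_lt_trans (leb_cube_le _ l0) _; rewrite ltry.
Qed.

Lemma maximal_ge0 x : 0 <= maximal f x.
Proof.
apply: le_trans (ereal_sup_ubound _); last first.
  by exists (cube x 1) => //; exists x, 1%R.
by rewrite mule_ge0// /average mule_ge0 ?integral_ge0// inve_ge0 measure_ge0.
Qed.

Lemma integral_cube_le_maximal a l x : (0 < l)%R -> cube a l x ->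
  \int[@leb R n]_(y in cube a l) `|f y|%:E <= @leb R n (cube a l) * maximal f x.
Proof.
move=> l0 ax; have : average f (cube a l) <= maximal f x.
  apply: ereal_sup_ubound; exists (cube a l); first by exists a, l.
  by rewrite indicE mem_set// mule1.
rewrite /average; have := leb_cube_gt0 a l0.
rewrite -(fineK (leb_cube_fin_num a l0)) lte_fin => c1.
by rewrite inver gt_eqF// -lee_pdivrMl//.
Qed.

(** Origin of the constant: a box is covered by cubes of side 2 d, which costs 2 ^ n.+1, with up to
    2 L_i / d of them along the edge of length L_i, which costs another 2 ^ n.+1. The remaining
    factor 2 leaves density one half. *)
Let dens t :=
  [set x | (t <= `|f x|)%R /\ (2 * 4 ^+ n.+1)%:E * maximal f x <= t%:E].

(** If the cube meets [dens t] at x, Chebyshev's inequality bounds t times the measure by the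
    integral of |f| over the cube, and this is at most the volume times [maximal f x], which is
    small compared with t. *)
Lemma leb_outer_dens_cube t a l : (0 < t)%R -> (0 < l)%R ->
  leb_outer (dens t `&` cube a l) <= (l ^+ n.+1 / (2 * 4 ^+ n.+1))%:E.
Proof.
move=> t0 l0; have k0 : (0 < 2 * 4 ^+ n.+1 :> R)%R
  by rewrite mulr_gt0// exprn_gt0.
have [->|/set0P[x [[_ xt] ax]]] := eqVneq (dens t `&` cube a l) set0.
  by rewrite leb_outer0 lee_fin divr_ge0 ?ltW// exprn_gt0.
rewrite -(@lee_pmul2l _ t%:E)//.
pose S := cube a l `&` [set y | t%:E <= `|(f y)%:E|].
apply: (@le_trans _ _ (t%:E * @leb R n S)).
  by rewrite lee_pmul2l//; apply: le_leb_outer => y [[ty _] ay]; split.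
have mQ : measurable (cube a l : set (Rn R n)) by exact: measurable_cube.
have mfQ : measurable_fun (cube a l : set (Rn R n)) (EFin \o f).
  by apply/measurable_EFinP; exact: measurable_funS mf.
apply: le_trans (le_integral_abse (@leb R n) mQ mfQ t0) _.
apply: le_trans (integral_cube_le_maximal l0 ax) _.
move: xt; rewrite -lee_pdivlMl// => xt.
apply: (@le_trans _ _ ((l ^+ n.+1)%:E * ((2 * 4 ^+ n.+1)^-1%:E * t%:E))).
  by apply: lee_pmul => //; [exact: maximal_ge0|exact: leb_cube_le].
by rewrite -!EFinM lee_fin; nra.
Qed.

(* Cubes with side the shortest edge of the box cover it with total volume at
   most 2 ^ (n + 1) times its own. *)
Lemma leb_outer_dens_box t (B : 'rV[R]_n.+1 * 'rV[R]_n.+1) : (0 < t)%R ->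
  leb_outer (dens t `&` box B) <= (2^-1 * box_volume B)%:E.
Proof.
move=> t0.
have [[i Bi]|Bpos] := pselect (exists i, (B.2 ord0 i <= B.1 ord0 i)%R).
  rewrite [X in leb_outer X](_ : _ = set0).
    by rewrite leb_outer0 EFinM mule_ge0 ?box_volume_ge0.
  by apply/seteqP; split=> // x [_ /(_ i) /andP[/lt_le_trans h /h]];
    rewrite ltNge Bi.
have {}Bpos i : (0 < B.2 ord0 i - B.1 ord0 i)%R.
  by rewrite subr_gt0 ltNge; apply/negP => h; apply: Bpos; exists i.
set L := fun i => (B.2 ord0 i - B.1 ord0 i)%R in Bpos *.
have [d d0 dL] : exists2 d : R, (0 < d)%R & forall i, (d <= L i)%R.
  exists (\big[Num.min/L ord0]_i L i); last first.
    by move=> i; exact: bigmin_le_cond.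
  by elim/big_ind: _ => [|y z y0 z0|i _]; rewrite ?lt_min ?y0 ?z0//;
    exact: Bpos.
pose N i := (Num.truncn (L i / d)).+1.
have NL i : ((N i)%:R * d <= 2 * L i)%R.
  have : ((Num.truncn (L i / d))%:R <= L i / d)%R.
    by rewrite truncn_le// divr_ge0// ltW// Bpos.
  by rewrite /N -natr1 ler_pdivlMr//; have := dL i; nra.
(* Each closed grid cell of side d lies in the open cube of side 2 d with the same centre, so no
   point on a cell boundary is lost. *)
pose Q (j : {dffun forall i, 'I_(N i)}) :=
  cube (\row_i (B.1 ord0 i + ((j i)%:R - 2^-1) * d))%R (2 * d).
have BQ : dens t `&` box B `<=`
    \big[setU/set0]_(j : {dffun forall i, 'I_(N i)}) (dens t `&` Q j).
  move=> x [tx Bx].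
  pose y i := ((x ord0 i - B.1 ord0 i) / d)%R.
  have y0 i : (0 <= y i)%R.
    by rewrite divr_ge0// ?ltW// subr_gt0; have /andP[] := Bx i.
  have yN i : (Num.truncn (y i) < N i)%N.
    rewrite ltnS le_truncn// ler_pM2r ?invr_gt0// lerD2r.
    by have /andP[] := Bx i.
  rewrite -bigcup_seq; exists [ffun i => Ordinal (yN i)] => /=.
    by rewrite mem_index_enum.
  split=> // i; rewrite !mxE ffunE /=.
  have := truncnS_gt (y i); have : ((Num.truncn (y i))%:R <= y i)%R.
    by rewrite truncn_le.
  rewrite -natr1 /y ler_pdivlMr// ltr_pdivrMr// => h1 h2.
  by apply/andP; split; nra.
apply: le_trans (le_leb_outer BQ) _.
apply: (@le_trans _ _ (\sum_(j : {dffun forall i, 'I_(N i)})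
    leb_outer (dens t `&` Q j))).
  elim/big_ind2 : _ => //; first by rewrite leb_outer0.
  move=> X1 y1 X2 y2 h1 h2.
  apply: le_trans (outer_measureU2 (@leb_outer R n) _ _) _; exact: leeD.
apply: (@le_trans _ _ (\sum_(j : {dffun forall i, 'I_(N i)})
    ((2 * d) ^+ n.+1 / (2 * 4 ^+ n.+1))%:E)).
  by apply: lee_sum => j _; apply: leb_outer_dens_cube => //; rewrite mulr_gt0.
rewrite sumEFin lee_fin sumr_const card_dep_ffun foldrE big_map big_enum/=.
rewrite (eq_bigl xpredT)//.
under eq_bigr do rewrite card_ord.
have dE (c : R) : (c ^+ n.+1 = \prod_(i < n.+1) c)%R.
  by rewrite prodr_const card_ord.
have NB : ((\prod_(i < n.+1) N i)%N%:R * d ^+ n.+1 <=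
    2 ^+ n.+1 * box_volume B)%R.
  rewrite natr_prod !dE -!big_split /=; apply: ler_prod => i _.
  by rewrite mulr_ge0 ?(ltW d0)//= (max_idPr _) ?NL// ltW.
have k0 : (0 < 2 ^+ n.+1 :> R)%R by rewrite exprn_gt0.
rewrite -[leLHS]mulr_natr exprMn (_ : 4 = 2 * 2)%R ?exprMn; last
  by rewrite -natrM.
move: NB; set P := (_%:R)%R; set D := (d ^+ n.+1)%R; set E := (2 ^+ n.+1)%R.
move=> NB; rewrite (_ : _ * P = (P * D) * (2 * E)^-1)%R; last first.
  by field; rewrite gt_eqF.
rewrite ler_pdivrMr ?mulr_gt0//; apply: le_trans NB _.
by rewrite [leRHS](_ : _ = E * box_volume B)%R//; field.
Qed.

Lemma leb_outer_dens t : (0 < t)%R -> leb_outer (dens t) = 0.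
Proof.
move=> t0; apply/eqP; rewrite eq_le leb_outer_ge0 andbT.
(* Inside a cube the outer measure is finite, so that being at most half of itself forces it to be
   0. *)
have denscover : dens t `<=` \bigcup_k (dens t `&` centered_cube R n k).
  by rewrite -setI_bigcupr bigcup_centered_cube setIT.
apply: le_trans (le_leb_outer denscover) _.
apply: le_trans (leb_outer_sigma_subadditive _) _.
rewrite eseries0// => k _ _; set E := dens t `&` _.
have Efin : leb_outer E \is a fin_num.
  rewrite ge0_fin_numE ?leb_outer_ge0//.
  apply: le_lt_trans (le_leb_outer (@subIsetr _ _ _)) _.
  apply: le_lt_trans (leb_cube_le _ _) _; rewrite ?ltry//.
(* [E] has density at most 1/2 in every box, hence in every cover of itself. *)
suff : 2%:E * leb_outer E <= leb_outer E.
  rewrite -(fineK Efin) -EFinM lee_fin => h; congr EFin; apply/eqP.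
  rewrite eq_le fine_ge0 ?leb_outer_ge0// andbT.
  by move: h; rewrite -subr_le0; set z := fine _; lra.
apply: leb_outer_ge => B EB.
have EB' : E `<=` \bigcup_k (dens t `&` box (B k)).
  by rewrite -setI_bigcupr => x Ex; split; [case: Ex|exact: EB].
rewrite -lee_pdivlMl// -nneseriesZl//; last by move=> *; exact: box_volume_ge0.
apply: le_trans (le_leb_outer EB') _.
apply: le_trans (leb_outer_sigma_subadditive _) _.
apply: lee_nneseries => [*|j _]; first exact: leb_outer_ge0.
by rewrite -EFinM leb_outer_dens_box.
Qed.

(** At an exceptional point some positive rational t lies strictly between the two sides, which puts
    the point in [dens t]. There are countably many such t, and each [dens t] is null. *)
Lemma ae_le_maximal : \forall x \ae @leb R n,
  `|f x|%:E <= (2 * 4 ^+ n.+1)%:E * maximal f x.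
Proof.
have k0 : (0 < 2 * 4 ^+ n.+1 :> R)%R by rewrite mulr_gt0// exprn_gt0.
pose F (k : nat) : set (Rn R n) :=
  if unpickle k is Some r then
    if (0 < ratr r :> R)%R then dens (ratr r) else set0
  else set0.
have neg k : (@leb R n).-negligible (F k).
  rewrite /F; case: (unpickle k) => [r|]; last exact: negligible_set0.
  case: ifPn => [r0|_]; last exact: negligible_set0.
  exact/negligible_leb_outer/leb_outer_dens.
apply: negligibleS (negligible_bigcup neg) => x /= /negP; rewrite -ltNge => xf.
have m0 : 0 <= (2 * 4 ^+ n.+1)%:E * maximal f x.
  by rewrite mule_ge0 ?maximal_ge0// lee_fin ltW.
have mfin : (2 * 4 ^+ n.+1)%:E * maximal f x \is a fin_num.
  by rewrite ge0_fin_numE//; apply: lt_trans xf _; rewrite ltry.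
move: m0 xf; rewrite -(fineK mfin) lee_fin lte_fin => m0 xf.
have [r] := rat_in_itvoo xf; rewrite in_itv/= => /andP[mr rf].
have r0 := le_lt_trans m0 mr.
exists (pickle r); first exact: I.
rewrite /F pickleK r0.
by split; [exact: ltW|rewrite -(fineK mfin) lee_fin ltW].
Qed.

End density.

(** * Covering lemma *)

Section finite_vitali.
Context (T : Type) (R : realDomainType).
Variables (B B3 : nat -> set T) (rad : nat -> R).
Hypothesis B3P : forall i j, B i `&` B j !=set0 -> (rad i <= rad j)%R ->
  B i `<=` B3 j.

(** Greedy selection, with the list sorted by increasing [rad]. The head is treated after the tail:
    either it meets a selected set, which is at least as large and whose [B3] swallows it, or it
    joins the selection. *)
Lemma finite_vitali (s : seq nat) : exists D : seq nat,
  [/\ uniq D, {subset D <= s}, trivIset [set` D] B &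
      \bigcup_(i in [set` s]) B i `<=` \bigcup_(i in [set` D]) B3 i].
Proof.
have BB3 i : B i `<=` B3 i by move=> x Bx; apply: (@B3P i i) => //; exists x.
pose le_rad i j := (rad i <= rad j)%R.
have le_rad_trans : transitive le_rad by move=> i j k; exact: le_trans.
wlog : s / sorted le_rad s.
  have /[swap] /[apply] : sorted le_rad (sort le_rad s).
    by apply: sort_sorted => i j; exact: le_total.
  move=> [D [uD Ds tD sD]]; exists D; split=> //.
    by move=> i /Ds; rewrite mem_sort.
  by move=> x [i /= si Bx]; apply: sD; exists i => //=; rewrite mem_sort.
elim: s => [_|i s ih /= ps]; first by exists [::]; split=> // x [].
have [D [uD Ds tD sD]] := ih (path_sorted ps).
have le_i j : j \in s -> le_rad i j.
  by have /allP := order_path_min le_rad_trans ps; exact.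
have [[j jD ij]|disj] := pselect (exists2 j, j \in D & B i `&` B j !=set0).
  exists D; split=> // [j'|x [k /=]]; first
    by rewrite inE => /Ds ->; rewrite orbT.
  rewrite inE => /predU1P[->|ks] Bx; last by apply: sD; exists k.
  by exists j => //; apply: (B3P ij) => //; exact/le_i/Ds.
(* Since [B i] meets no selected set, a repeated index [i] is possible only if [B i] is empty. *)
have [iD|iD] := boolP (i \in D).
  exists D; split=> // [j'|x [k /=]]; first
    by rewrite inE => /Ds ->; rewrite orbT.
  rewrite inE => /predU1P[->|ks] Bx; last by apply: sD; exists k.
  by exists i => //; exact: BB3.
exists (i :: D); split=> /=.
- by rewrite iD.
- by move=> j; rewrite !inE => /predU1P[->|/Ds ->]; rewrite ?eqxx ?orbT.
- move=> j k /=; rewrite !inE => /predU1P[->|jD] /predU1P[->//|kD] jk.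
  + by exfalso; apply: disj; exists k.
  + by exfalso; apply: disj; exists j => //; rewrite setIC.
  + exact: tD jk.
- move=> x [k /=]; rewrite inE => /predU1P[->|ks] Bx.
    by exists i; [rewrite /= mem_head|exact: BB3].
  have [j jD B3x] : (\bigcup_(i in [set` D]) B3 i) x by apply: sD; exists k.
  by exists j => //=; rewrite inE jD orbT.
Qed.

End finite_vitali.

(** * Dyadic levels *)

Section dyadic_levels.
Context (R : realType).
Implicit Types (e a p G : R).

Lemma powR2_gt1 a : (0 < a)%R -> (1 < 2 `^ a :> R)%R.
Proof.
move=> a0; have := @gt0_ltr_powR _ _ a0 1%R 2%R; rewrite powR1 !nnegrE ler01.
by apply => //; rewrite ltr1n.
Qed.

(** A geometric sum stopped at the last level below [G]. The induction also carries a bound by the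
    next term [A m], which yields the bound by [G] as long as the level is below [G]. *)
Lemma sum_dyadic_powR_le e a G (m : nat) :
  (0 < e)%R -> (0 < a)%R -> (0 <= G)%R ->
  (\sum_(k < m) (e * 2 ^+ k) `^ a * (e * 2 ^+ k < G)%R%:R <=
   2 `^ a / (2 `^ a - 1) * G `^ a)%R.
Proof.
move=> e0 a0 G0; set rho := (2 `^ a)%R.
have rho1 : (1 < rho)%R by exact: powR2_gt1.
have l0 k : (0 <= e * 2 ^+ k)%R by rewrite mulr_ge0 ?exprn_ge0// ltW.
pose A k := ((e * 2 ^+ k) `^ a)%R.
have AS k : A k.+1 = (rho * A k)%R by rewrite /A exprSr mulrA powRM// mulrC.
pose S m := (\sum_(k < m) A k * (e * 2 ^+ k < G)%R%:R)%R.
suff : (S m * (rho - 1) <= A m)%R /\ (S m * (rho - 1) <= rho * G `^ a)%R.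
  by case=> _ h; rewrite mulrAC ler_pdivlMr ?subr_gt0.
elim: m => [|m [ih1 ih2]].
  rewrite /S big_ord0 mul0r; split; first exact: powR_ge0.
  by rewrite mulr_ge0 ?powR_ge0.
have -> : S m.+1 = (S m + A m * (e * 2 ^+ m < G)%R%:R)%R
  by rewrite /S big_ord_recr.
have A0 : (0 <= A m)%R by exact: powR_ge0.
rewrite AS; case: ltP => mG; last by rewrite mulr0 addr0; split=> //; nra.
have AG : (A m <= G `^ a)%R by rewrite ge0_ler_powR ?nnegrE// ltW.
by rewrite mulr1; split; nra.
Qed.

(** For finite [F] a single term suffices, that of the last level below [F], since [F] is at most
    twice that level. For [F = +oo] every term is at least (2 e) ^ p and the series diverges. *)
Lemma dyadic_levels_ge e p (F : \bar R) : (0 < e)%R -> (0 < p)%R -> e%:E < F ->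
  F `^ p <= \sum_(k <oo) ((2 * (e * 2 ^+ k)) `^ p *
                          ((e * 2 ^+ k)%:E < F)%E%:R)%:E.
Proof.
move=> e0 p0.
pose u k := ((2 * (e * 2 ^+ k)) `^ p * ((e * 2 ^+ k)%:E < F)%E%:R)%R.
have u0 k : 0 <= (u k)%:E by rewrite lee_fin mulr_ge0 ?powR_ge0.
rewrite -/(\sum_(k <oo) (u k)%:E).
case: F @u u0 => [r| |//] u u0 eF.
  have /ex_minnP[[|k]] : exists k, (r <= e * 2 ^+ k)%R.
    exists (Num.truncn (r / e)).+1.
    rewrite mulrC -ler_pdivrMr//; apply: le_trans (ltW (truncnS_gt _)) _.
    by rewrite -natrX ler_nat ltnW// ltn_expl.
    by rewrite expr0 mulr1 leNgt -lte_fin eF.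
  move=> rk /(_ k); rewrite ltnn leNgt => kr.
  have {}kr : (e * 2 ^+ k < r)%R by case: ltP kr => // _ /(_ isT).
  apply: le_trans (nneseries_lim_ge k.+1 (fun i _ _ => u0 i)).
  rewrite big_nat_recr//=; apply: (@le_trans _ _ (u k)%:E).
    rewrite lee_fin /u lte_fin kr mulr1 ge0_ler_powR ?nnegrE ?(ltW p0)//.
    - by apply: le_trans (ltW kr); rewrite mulr_ge0 ?exprn_ge0// ltW.
    - by rewrite mulr_ge0// mulr_ge0 ?exprn_ge0// ltW.
    - by rewrite mulrCA -exprS.
  by rewrite leeDr// sume_ge0.
rewrite poweRyr ?gt_eqF// leye_eq; apply/eqP/eq_infty => t.
pose c := ((2 * e) `^ p)%R.
have c0 : (0 < c)%R by rewrite powR_gt0// mulr_gt0.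
pose m := (Num.truncn (t / c)).+1.
apply: le_trans (nneseries_lim_ge m (fun i _ _ => u0 i)).
apply: (@le_trans _ _ (\sum_(0 <= k < m) c%:E)).
  rewrite sumEFin lee_fin big_const_nat subn0 iter_addr_0 -mulr_natr.
  by rewrite mulrC -ler_pdivrMr// ltW// truncnS_gt.
apply: lee_sum => k _; rewrite lee_fin /u ltry mulr1.
rewrite ge0_ler_powR ?nnegrE ?(ltW p0)//.
- by rewrite mulr_ge0// ltW.
- by rewrite mulr_ge0// mulr_ge0 ?exprn_ge0// ltW.
- by rewrite ler_pM2l// ler_peMr ?(ltW e0)// exprn_ege1// ler1n.
Qed.

(** 2 ^ p comes from replacing the function by twice the dyadic level below it, 2 D from
    [maximal_family_weak], the quotient from the geometric sum with exponent p - 1, and the last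
    factor from (2 g) ^ (p - 1). *)
Definition strong_constant p (D : R) : R :=
  (2 `^ p * (2 * D) * (2 `^ (p - 1) / (2 `^ (p - 1) - 1)) * 2 `^ (p - 1))%R.

Lemma strong_constant_ge0 p (D : R) : (1 < p)%R -> (0 <= D)%R ->
  (0 <= strong_constant p D)%R.
Proof.
move=> p1 D0; rewrite /strong_constant !mulr_ge0// ?powR_ge0// invr_ge0
  subr_ge0 ltW//.
by rewrite powR2_gt1// subr_gt0.
Qed.

End dyadic_levels.

(** * Maximal functions of families of sets *)

Section maximal_function_family.
Context d (T : measurableType d) (R : realType).
Variables (mu : {measure set T -> \bar R}) (v : T -> R).
Hypotheses (mv : measurable_fun [set: T] v) (v0 : forall x, (0 <= v x)%R).
Variables (B B3 : nat -> set T) (rad : nat -> R) (D : R).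
Hypotheses (mB : forall k, measurable (B k)).
Hypotheses (mB3 : forall k, measurable (B3 k)).
Hypothesis B3P : forall i j, B i `&` B j !=set0 -> (rad i <= rad j)%R ->
  B i `<=` B3 j.
Let nu A := \int[mu]_(x in A) (v x)%:E.
Hypothesis D0 : (0 <= D)%R.
Hypothesis nuB3 : forall k, nu (B3 k) <= D%:E * nu (B k).

Let vE0 x : 0 <= (v x)%:E. Proof. by rewrite lee_fin. Qed.

Let mvE A : measurable_fun A (EFin \o v).
Proof. by apply/measurable_EFinP; exact: measurable_funS mv. Qed.

Lemma integral_bigcup_seq_le (s : seq nat) (A : nat -> set T) :
  (forall k, measurable (A k)) ->
  nu (\bigcup_(k in [set` s]) A k) <= \sum_(k <- s) nu (A k).
Proof.
move=> mA; rewrite bigcup_seq.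
elim: s => [|k s ih]; first by rewrite !big_nil /nu integral_set0.
rewrite !big_cons; set U := \big[setU/set0]_(j <- s) A j in ih *.
have mU : measurable U by apply: bigsetU_measurable.
have -> : A k `|` U = A k `|` (U `\` A k).
  apply/seteqP; split=> x [Ax|]; [by left| |by left|by case=> ? _; right].
  by move=> Ux; have [Ax|Ax] := pselect (A k x); [left|right].
have mUA : measurable (U `\` A k) by exact: measurableD.
rewrite {1}/nu ge0_integral_setU//; last first.
  by apply/eqP/seteqP; split=> // x [Ax [_]].
rewrite leeD2l//; apply: le_trans ih.
by apply: ge0_subset_integral => // x [].
Qed.

(** The average of [H] over [B k] relative to [nu] exceeds t, written without a division by
    [nu (B k)]. *)
Let bad (t : R) (H : T -> \bar R) k :=
  t%:E * nu (B k) < \int[mu]_(x in B k) H x.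

Lemma weak_type_finite (t : R) (H : T -> \bar R) (s : seq nat) :
  (0 <= t)%R -> measurable_fun [set: T] H -> (forall x, 0 <= H x) ->
  all (bad t H) s ->
  t%:E * nu (\bigcup_(k in [set` s]) B k) <= D%:E * \int[mu]_x H x.
Proof.
move=> t0 mH H0 sbad; have [S [uS Ss tS sS]] := finite_vitali B3P s.
have nu_ge0 k : 0 <= nu (B k) by exact: integral_ge0.
apply: (@le_trans _ _ (t%:E * nu (\bigcup_(k in [set` S]) B3 k))).
  rewrite lee_wpmul2l// ge0_subset_integral//; rewrite bigcup_seq.
    exact: bigsetU_measurable.
  exact: bigsetU_measurable.
apply: (@le_trans _ _ (t%:E * (D%:E * \sum_(k <- S) nu (B k)))).
  rewrite lee_wpmul2l//; apply: le_trans (integral_bigcup_seq_le _ mB3) _.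
  rewrite ge0_sume_distrr//.
  exact: lee_sum.
rewrite muleCA lee_wpmul2l// ge0_sume_distrr//.
apply: (@le_trans _ _ (\sum_(k <- S) \int[mu]_(x in B k) H x)).
  rewrite big_seq [leRHS]big_seq; apply: lee_sum => k /Ss ks.
  by have /allP := sbad => /(_ k ks) /ltW.
have mU : measurable (\big[setU/set0]_(k <- S) B k)
  by exact: bigsetU_measurable.
rewrite -ge0_integral_bigsetU//; last exact: measurable_funS mH.
exact: ge0_subset_integral.
Qed.

(** [finite_vitali] takes finite lists, so the bad indices below m are treated first. The bound is
    uniform in m and passes to the increasing union. *)
Lemma weak_type (t : R) (H : T -> \bar R) :
  (0 <= t)%R -> measurable_fun [set: T] H -> (forall x, 0 <= H x) ->
  t%:E * nu (\bigcup_(k in [set k | bad t H k]) B k) <= D%:E * \int[mu]_x H x.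
Proof.
move=> t0 mH H0.
pose E m := \bigcup_(k in [set` [seq k <- iota 0 m | bad t H k]]) B k.
have mE m : measurable (E m)
  by rewrite /E bigcup_seq; exact: bigsetU_measurable.
have UE : \bigcup_(k in [set k | bad t H k]) B k = \bigcup_m E m.
  apply/seteqP; split=> x.
    move=> [k bk Bx]; exists k.+1 => //; exists k => //.
    rewrite /mkset mem_filter mem_iota add0n ltnSn leq0n.
    by apply/andP.
  by move=> [m _ [k /=]]; rewrite mem_filter => /andP[bk _] Bx; exists k.
have ndE : nondecreasing_seq E.
  move=> i j ij; apply/subsetPset => x [k /=].
  rewrite mem_filter mem_iota => /andP[bk ki] Bx; exists k => //=.
  by rewrite mem_filter bk mem_iota/= (leq_trans ki).
have cvgE : t%:E * nu (E m) @[m --> \oo] --> t%:E * nu (\bigcup_m E m).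
  by apply: cvgeZl => //; exact: ge0_nondecreasing_set_cvg_integral.
rewrite UE -(cvg_lim _ cvgE)//; apply: lime_le; first by apply/cvgP: cvgE.
apply: nearW => m; apply: weak_type_finite => //.
by apply/allP => k; rewrite mem_filter => /andP[].
Qed.

Variable (g : T -> R).
Hypotheses (mg : measurable_fun [set: T] g) (g0 : forall x, (0 <= g x)%R).
Hypothesis nuB_gt0 : forall k x, B k x -> 0 < nu (B k).
Hypothesis nuB_fin : forall k, nu (B k) \is a fin_num.

Let gv x := (g x * v x)%:E.

Let mgv A : measurable_fun A gv.
Proof.
by apply: measurable_funS (subsetT A) _ => //;
  apply/measurable_EFinP/measurable_funM.
Qed.

Let gv0 x : 0 <= gv x. Proof. by rewrite lee_fin mulr_ge0. Qed.

(* Where [nu (B k) = 0] the inverse is +oo, but then [B k] is empty. *)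
Definition maximal_family (x : T) : \bar R :=
  ereal_sup (range (fun k =>
    (nu (B k))^-1 * \int[mu]_(y in B k) gv y * (\1_(B k) x)%:E)).

Lemma maximal_family_ge0 x : 0 <= maximal_family x.
Proof.
apply: le_trans (ereal_sup_ubound _); last by exists 0%N.
by rewrite !mule_ge0 ?integral_ge0// inve_ge0 integral_ge0.
Qed.

Lemma maximal_family_gtE (t : R) : (0 <= t)%R ->
  [set x | t%:E < maximal_family x] = \bigcup_(k in [set k | bad t gv k]) B k.
Proof.
move=> t0.
have nuE k y : B k y -> bad t gv k =
    (t%:E < (nu (B k))^-1 * \int[mu]_(y in B k) gv y).
  move=> /nuB_gt0; rewrite /bad -(fineK (nuB_fin k)) lte_fin => c0.
  by rewrite inver gt_eqF// lte_pdivlMl// muleC.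
apply/seteqP; split=> x /=.
  move=> /ereal_sup_gt[_ [k _ <-]]; have [Bx|Bx] := pselect (B k x).
    by rewrite indicE mem_set// mule1 -(nuE k x)// => ?; exists k.
  by rewrite indicE memNset// mule0 lte_fin ltNge t0.
move=> [k /= + Bx]; rewrite (nuE k x)// => /lt_le_trans; apply.
apply: ereal_sup_ubound; exists k => //.
by rewrite indicE mem_set// mule1.
Qed.

Lemma measurable_maximal_family : measurable_fun [set: T] maximal_family.
Proof.
have -> : maximal_family = fun x => esups (fun k =>
    (nu (B k))^-1 * \int[mu]_(y in B k) gv y * (\1_(B k) x)%:E) 0%N.
  apply/funext => x; rewrite /maximal_family /esups /=; congr ereal_sup.
  by rewrite /sdrop; congr image; apply/seteqP; split.
apply: measurable_fun_esups => k; apply: emeasurable_funM => //.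
exact/measurable_EFinP/measurable_indic.
Qed.

Let measurable_gt (t : R) : measurable [set x | t%:E < maximal_family x].
Proof.
rewrite -[X in measurable X]setTI.
exact: emeasurable_fun_o_infty measurable_maximal_family _.
Qed.

(** Restricting the right side to t < 2 g makes the sum over dyadic levels converge: at each point
    only the levels below 2 g contribute. With the whole integral on the right, the sum would
    diverge. *)
Lemma maximal_family_weak (t : R) : (0 < t)%R ->
  t%:E * nu [set x | t%:E < maximal_family x] <=
  (2 * D)%:E * \int[mu]_(x in [set x | t < 2 * g x]%R) gv x.
Proof.
move=> t0; set S := [set x | (t < 2 * g x)%R].
have mS : measurable S.
  have := emeasurable_fun_o_infty measurableT
    (_ : measurable_fun setT (fun x => (2 * g x)%:E)) t%:E.
  rewrite setTI; apply; apply/measurable_EFinP; exact: measurable_funM.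
(* Where [2 * g x <= t] the function contributes at most half of the level. *)
pose H := gv \_ S.
have H0 x : 0 <= H x by rewrite /H patchE; case: ifP.
have mH : measurable_fun [set: T] H by apply/(measurable_restrictT _ mS).
have badH : [set k | bad t gv k] `<=` [set k | bad (t / 2) H k].
  move=> k; rewrite /bad/= => tk.
  have : \int[mu]_(x in B k) gv x <=
      \int[mu]_(x in B k) H x + (t / 2)%:E * nu (B k).
    rewrite /nu -ge0_integralZl//; last first.
      by rewrite lee_fin divr_ge0// ltW.
    rewrite -ge0_integralD//; last 3 first.
    - exact: measurable_funS mH.
    - by move=> x _; rewrite mule_ge0// lee_fin divr_ge0// ltW.
    - exact: measurable_funeM.
    apply: ge0_le_integral => //.
    - apply: emeasurable_funD; first exact: measurable_funS mH.
      exact: measurable_funeM.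
    - move=> x _; rewrite /H patchE; case: ifPn => [_|].
        by rewrite leeDl// mule_ge0// lee_fin divr_ge0// ltW.
      rewrite notin_setE /S/= => /negP; rewrite -leNgt => gt.
      by rewrite add0e -EFinM lee_fin ler_wpM2r//; lra.
  move/(lt_le_trans tk); rewrite -lteBlDr; last by rewrite fin_numM.
  by rewrite -muleBl ?fin_num_adde_defl// -EFinB (_ : t - t / 2 = t / 2)%R//;
    lra.
rewrite maximal_family_gtE ?(ltW t0)//.
have th0 : (0 <= t / 2)%R by rewrite divr_ge0// ltW.
have := weak_type th0 mH H0.
rewrite /H -integral_mkcond => wt.
have mbad t' H' : measurable (\bigcup_(k in [set k | bad t' H' k]) B k).
  by apply: bigcup_measurable => k _.
have scale (X X' Y : \bar R) (s : R) : (0 <= s)%R -> X <= X' ->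
    s%:E * X' <= D%:E * Y -> (2 * s)%:E * X <= (2 * D)%:E * Y.
  move=> s0 XX' sX; rewrite !(EFinM 2) -!muleA lee_pmul2l//.
  by apply: le_trans sX; rewrite lee_wpmul2l.
rewrite [t in t%:E * _](_ : t = 2 * (t / 2))%R; last by field.
apply: (scale _ _ _ _ th0 _ wt); apply: ge0_subset_integral.
- exact: mbad.
- exact: mbad.
- exact: mvE.
- by move=> x _; exact: vE0.
- by move=> x [k /badH bk Bx]; exists k.
Qed.

Variable p : R.
Hypothesis p1 : (1 < p)%R.

Let sum_levels_le e x : (0 < e)%R ->
  \sum_(k <oo) (2 `^ p * (e * 2 ^+ k) `^ (p - 1) * (2 * D) *
    (e * 2 ^+ k < 2 * g x)%R%:R * (g x * v x))%:E <=
  (strong_constant p D * (g x `^ p * v x))%:E.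
Proof.
move=> e0; have p10 : (0 < p - 1)%R by rewrite subr_gt0.
apply: lime_le.
  apply: is_cvg_nneseries => k _ _.
  by rewrite lee_fin !mulr_ge0// powR_ge0.
apply: nearW => m; rewrite big_mkord sumEFin lee_fin.
have gx0 : (0 <= 2 * g x)%R by rewrite mulr_ge0.
have := sum_dyadic_powR_le m e0 p10 gx0.
set K := (2 `^ (p - 1) / _)%R; rewrite powRM// => h.
have c0 : (0 <= 2 `^ p * (2 * D) * (g x * v x))%R
  by rewrite !mulr_ge0// powR_ge0.
rewrite [leLHS](_ : _ = 2 `^ p * (2 * D) * (g x * v x) * \sum_(k < m)
    (e * 2 ^+ k) `^ (p - 1) * (e * 2 ^+ k < 2 * g x)%R%:R)%R; last first.
  by rewrite mulr_sumr; apply: eq_bigr => k _; ring.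
apply: le_trans (ler_wpM2l c0 h) _.
rewrite -(@mulr_powRB1 _ (g x) p)//; last by rewrite (lt_trans _ p1).
by rewrite /strong_constant -/K le_eqVlt; apply/orP; left; apply/eqP; ring.
Qed.

(** The levels e 2 ^ k with k >= 0 only see the values above e. The constant does not depend on e,
    which later tends to 0. *)
Let strong_above e : (0 < e)%R ->
  \int[mu]_(x in [set x | e%:E < maximal_family x])
    (maximal_family x `^ p * (v x)%:E) <=
  (strong_constant p D)%:E * \int[mu]_x (g x `^ p * v x)%:E.
Proof.
move=> e0; have p0 : (0 < p)%R by exact: lt_trans p1.
have l0 k : (0 < e * 2 ^+ k)%R by rewrite mulr_gt0// exprn_gt0.
pose A k := [set x | (e * 2 ^+ k)%:E < maximal_family x].
pose S k := [set x | (e * 2 ^+ k < 2 * g x)%R].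
have mA k : measurable (A k) by exact: measurable_gt.
have mS k : measurable (S k).
  have := emeasurable_fun_o_infty measurableT
    (_ : measurable_fun setT (fun x => (2 * g x)%:E)) (e * 2 ^+ k)%:E.
  rewrite setTI; apply; apply/measurable_EFinP; exact: measurable_funM.
(* [u] and [w] are the two sides of the weak type bound at the level l = e 2 ^ k: one factor l of l
   ^ p is spent on that bound, which leaves l ^ (p - 1) in [w]. *)
pose u k x := (((2 * (e * 2 ^+ k)) `^ p)%:E * ((v x)%:E * (\1_(A k) x)%:E)).
pose w k x := ((2 `^ p * (e * 2 ^+ k) `^ (p - 1) * (2 * D))%:E *
  (gv x * (\1_(S k) x)%:E)).
have u0 k x : 0 <= u k x by rewrite !mule_ge0// lee_fin powR_ge0.
have w0 k x : 0 <= w k x.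
  by rewrite !mule_ge0// lee_fin !mulr_ge0// powR_ge0.
have mu_ k : measurable_fun setT (u k).
  apply: measurable_funeM; apply: emeasurable_funM => //.
  by apply/measurable_EFinP/measurable_indic.
have mw k : measurable_fun setT (w k).
  apply: measurable_funeM; apply: emeasurable_funM => //.
  by apply/measurable_EFinP/measurable_indic.
have uw k : \int[mu]_x u k x <= \int[mu]_x w k x.
  have mind (E : set T) : measurable E ->
      measurable_fun [set: T] (fun x => (\1_E x)%:E : \bar R).
    by move=> mE; apply/measurable_EFinP/measurable_indic.
  rewrite /u /w ge0_integralZl//; last 3 first.
  - by apply: emeasurable_funM => //; exact: mind.
  - by move=> x _; rewrite mule_ge0.
  - by rewrite lee_fin powR_ge0.
  rewrite ge0_integralZl//; last 3 first.
  - by apply: emeasurable_funM => //; exact: mind.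
  - by move=> x _; rewrite mule_ge0.
  - by rewrite lee_fin !mulr_ge0// powR_ge0.
  rewrite -epatch_indic -integral_mkcond -epatch_indic -integral_mkcond.
  have := maximal_family_weak (l0 k); rewrite -/(A k) -/(S k) -/(nu (A k)) => h.
  rewrite powRM// ?(ltW (l0 k))// -(@mulr_powRB1 _ (e * 2 ^+ k) p)// 
    ?(ltW (l0 k))//.
  have split_mul (a b : R) (X : \bar R) : (a * b)%:E * X = a%:E * (b%:E * X).
    by rewrite EFinM muleA.
  by rewrite mulrA mulrAC 2!split_mul lee_wpmul2l// lee_fin mulr_ge0// powR_ge0.
apply: (@le_trans _ _ (\int[mu]_x \sum_(k <oo) u k x)).
  apply: (@le_trans _ _ (\int[mu]_(x in A 0%N) \sum_(k <oo) u k x)).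
    have -> : [set x | e%:E < maximal_family x] = A 0%N.
      by rewrite /A expr0 mulr1.
    apply: ge0_le_integral_nonmeasurable => x Fx.
      by rewrite mule_ge0// poweR_ge0.
    have := dyadic_levels_ge e0 p0 (_ : e%:E < maximal_family x).
    rewrite {1}/A /= expr0 mulr1 in Fx.
    move=> /(_ Fx)/(lee_wpmul2r (vE0 x))/le_trans; apply.
    rewrite muleC -nneseriesZl; last
      by move=> k _; rewrite lee_fin mulr_ge0// powR_ge0.
    apply: lee_nneseries => k _ *; first
      by rewrite mule_ge0// lee_fin mulr_ge0// powR_ge0.
    rewrite /u muleC EFinM -muleA (muleC _ (v x)%:E) indicE.
    have -> : ((e * 2 ^+ k)%:E < maximal_family x)%E = (x \in A k).
      by apply/idP/idP; rewrite inE.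
    by [].
  rewrite integral_mkcond; apply: ge0_le_integral_nonmeasurable => x _.
    by apply: erestrict_ge0 => y _; exact: nneseries_ge0.
  by rewrite patchE; case: ifP => // _; exact: nneseries_ge0.
rewrite integral_nneseries//.
apply: (@le_trans _ _ (\sum_(k <oo) \int[mu]_x w k x)).
  by apply: lee_nneseries => // k _ _; exact: integral_ge0.
rewrite -integral_nneseries// -ge0_integralZl//; last 3 first.
- apply/measurable_EFinP/measurable_funM => //.
  exact: (@measurableT_comp _ _ _ _ _ _ (@powR R ^~ p)).
- by move=> x _; rewrite lee_fin mulr_ge0// powR_ge0.
- by rewrite lee_fin strong_constant_ge0.
apply: ge0_le_integral_nonmeasurable => x _; first exact: nneseries_ge0.
rewrite -EFinM; apply: le_trans (sum_levels_le x e0).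
apply: lee_nneseries => k _ *; first exact: w0.
rewrite /w /gv indicE -!EFinM lee_fin.
have -> : (x \in S k) = (e * 2 ^+ k < 2 * g x)%R by apply/idP/idP; rewrite inE.
by rewrite le_eqVlt; apply/orP; left; apply/eqP; ring.
Qed.

Lemma maximal_family_strong :
  \int[mu]_x (maximal_family x `^ p * (v x)%:E) <=
  (strong_constant p D)%:E * \int[mu]_x (g x `^ p * v x)%:E.
Proof.
have p0 : (0 < p)%R by exact: lt_trans p1.
pose E i := [set x | (i.+1%:R^-1)%:E < maximal_family x].
have UE : \bigcup_i E i = [set x | 0 < maximal_family x].
  apply/seteqP; split=> x.
    by move=> [i _]; apply: lt_trans; rewrite lte_fin invr_gt0.
  move=> /= F0; suff [i iF] : exists i, (i.+1%:R^-1)%:E < maximal_family x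
    by exists i.
  case: (maximal_family x) F0 => [r| |//]; last by exists 0%N; rewrite ltry.
  rewrite lte_fin => r0; exists (Num.truncn r^-1); rewrite lte_fin.
  by rewrite invf_plt ?posrE// truncnS_gt.
have ndE : nondecreasing_seq E.
  move=> i j ij; apply/subsetPset => x; apply: le_lt_trans.
  by rewrite lee_fin lef_pV2 ?posrE// ler_nat.
have mF : measurable_fun [set: T] (fun x => maximal_family x `^ p * (v x)%:E).
  apply: emeasurable_funM => //.
  exact: (measurableT_comp (measurable_poweR _) measurable_maximal_family).
have cvgE :
    \int[mu]_(x in E i) (maximal_family x `^ p * (v x)%:E) @[i --> \oo] -->
    \int[mu]_(x in \bigcup_i E i) (maximal_family x `^ p * (v x)%:E).
  apply: ge0_nondecreasing_set_cvg_integral => //.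
  - by move=> i; exact: measurable_gt.
  - by move=> i; exact: measurable_funS mF.
  - by move=> i x _; rewrite mule_ge0// poweR_ge0.
have -> : \int[mu]_x (maximal_family x `^ p * (v x)%:E) =
    \int[mu]_(x in \bigcup_i E i) (maximal_family x `^ p * (v x)%:E).
  rewrite [RHS]integral_mkcond; apply: eq_integral => x _; rewrite patchE.
  case: ifPn => //; rewrite UE notin_setE /= => /negP; rewrite -leNgt => F0.
  have -> : maximal_family x = 0
    by apply/eqP; rewrite eq_le F0 maximal_family_ge0.
  by rewrite poweR0r ?gt_eqF// mul0e.
rewrite -(cvg_lim _ cvgE)//; apply: lime_le; first by apply/cvgP: cvgE.
by apply: nearW => i; apply: strong_above; rewrite invr_gt0.
Qed.

End maximal_function_family.

(** * A_1 weights *)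

Section A1_weights.
Context (R : realType) (n : nat) (v : Rn R n -> R).
Hypothesis wv : weight v.
Implicit Types (a : 'rV[R]_n.+1) (l : R) (x : Rn R n).

Let mu := @leb R n.
Let mv : measurable_fun [set: Rn R n] v. Proof. by case: wv. Qed.
Let v0 x : (0 <= v x)%R. Proof. by case: wv => _ + _ _; exact. Qed.
Let mvE A : measurable_fun A (EFin \o v).
Proof. by apply/measurable_EFinP; exact: measurable_funS mv. Qed.

Lemma weight_cube_unit_gt0 : 0 < @leb R n (cube 0 1).
Proof.
by case: wv => _ _ _ vpos; move: vpos; rewrite lt0e => /andP[/cube_unit_gt0].
Qed.
Let c0 := weight_cube_unit_gt0.

Lemma weight_integral_cube_fin a l : \int[mu]_(x in cube a l) (v x)%:E < +oo.
Proof.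
pose K : set 'rV[R]_n.+1 :=
  [set x | forall i, (a ord0 i <= x ord0 i <= a ord0 i + l)%R].
case: wv => _ _ /(_ K (@compact_closed_cube R n a l)) + _; apply: le_lt_trans.
rewrite integral_mkcond [leRHS]integral_mkcond.
apply: ge0_le_integral_nonmeasurable => x _.
  by apply: erestrict_ge0 => y _; rewrite lee_fin.
rewrite !patchE; case: ifPn => [|_]; last first.
  by case: ifP => //; rewrite lee_fin.
rewrite inE => ax; rewrite mem_set ?lee_fin ?ler_norm// => i.
by have /andP[/ltW -> /ltW ->] := ax i.
Qed.

(** If [maximal v x] were 0, [v] would have integral 0 over every cube containing x. Such cubes
    exhaust the space, so [v] would vanish almost everywhere. *)
Lemma weight_maximal_gt0 x : 0 < maximal v x.
Proof.
rewrite lt0e maximal_ge0 andbT; apply/negP => /eqP Mx0.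
have [k0 _ xk0] : (\bigcup_k centered_cube R n k) x
  by rewrite bigcup_centered_cube.
have neg k :
    mu.-negligible (centered_cube R n (k + k0) `&` [set y | v y != 0%R]).
  have l0 : (0 < 2 * (k + k0).+1%:R :> R)%R by rewrite mulr_gt0.
  have xk : centered_cube R n (k + k0) x
    by apply: centered_cube_sub xk0; exact: leq_addl.
  have mQ : measurable (centered_cube R n (k + k0) : set (Rn R n))
    by exact: measurable_cube.
  have := integral_cube_le_maximal v c0 l0 xk; rewrite Mx0 mule0 => I0.
  have /(ae_eq_integral_abs mu mQ (@mvE _)) :
      \int[mu]_(y in centered_cube R n (k + k0)) `|(v y)%:E| = 0.
    by apply/eqP; rewrite eq_le I0 integral_ge0.
  apply: negligibleS => y [yk /eqP vy] /= /(_ yk) [].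
  by move/vy.
have : mu.-negligible [set y | (0 < v y)%R].
  apply: negligibleS (negligible_bigcup neg) => y /= vy.
  have [k _ yk] : (\bigcup_k centered_cube R n k) y
    by rewrite bigcup_centered_cube.
  by exists k => //; split;
    [exact: centered_cube_sub (leq_addr _ _) _ yk|exact: lt0r_neq0].
case: wv => _ _ _ vpos [N [mN N0 vN]]; have := le_leb_outer vN.
by rewrite leNgt => /negP; apply; rewrite [X in X < _]N0.
Qed.

(* If [v x = 0], the quotient in the A_1 constant is +oo at [x]. *)
Lemma A1_ae : A1_constant v < +oo -> exists2 A : R, (0 < A)%R &
  \forall x \ae mu, (0 < v x)%R /\ maximal v x <= (A * v x)%:E.
Proof.
move=> vA; have [A A0 hA] : exists2 A : R, (0 < A)%R & A1_constant v <= A%:E.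
  move: vA; case: (A1_constant v) => [r _|//|_]; last
    by exists 1%R; rewrite ?leNye.
  by exists (Num.max 1 r)%R; rewrite ?lt_max ?ltr01// lee_fin le_max lexx orbT.
exists A => //.
apply: filterS (ess_sup_ge mu (fun x => maximal v x / (v x)%:E)).
move=> x /le_trans /(_ hA) h.
have vx : (0 < v x)%R.
  rewrite lt0r v0 andbT; apply: contraPneq h => ->.
  by rewrite inve0 gt0_muley ?weight_maximal_gt0// leNgt ltry.
by split=> //; move: h; rewrite inver gt_eqF// lee_pdivrMr// EFinM.
Qed.

Variable A : R.
Hypothesis A0 : (0 < A)%R.
Hypothesis hA : \forall x \ae mu, (0 < v x)%R /\ maximal v x <= (A * v x)%:E.

Let vE0 x : 0 <= (v x)%:E. Proof. by rewrite lee_fin. Qed.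
Let mQ a l : measurable (cube a l : set (Rn R n)).
Proof. exact: measurable_cube. Qed.

Lemma A1_integral_cube_gt0 a l : (0 < l)%R ->
  0 < \int[mu]_(x in cube a l) (v x)%:E.
Proof.
move=> l0; rewrite lt0e integral_ge0 ?andbT//; apply/negP => /eqP I0.
have /(ae_eq_integral_abs mu (mQ a l) (@mvE _)) v_eq0 :
    \int[mu]_(x in cube a l) `|(v x)%:E| = 0.
  by rewrite -[RHS]I0; apply: eq_integral => x _; rewrite gee0_abs.
have : mu.-negligible (cube a l : set (Rn R n)).
  apply: negligibleS (negligibleU v_eq0 hA) => x ax /=.
  have [vx|vx] := pselect (0 < v x)%R; last by right => -[].
  by left => /(_ ax) [] /eqP; rewrite gt_eqF.
move/(measure_negligible (mQ a l))/eqP; rewrite gt_eqF//.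
exact: leb_cube_gt0.
Qed.

Lemma A1_integral_cube_le a l x : (0 < l)%R -> cube a l x ->
  maximal v x <= (A * v x)%:E ->
  \int[mu]_(y in cube a l) (v y)%:E <= mu (cube a l) * (A * v x)%:E.
Proof.
move=> l0 ax vx; have := integral_cube_le_maximal v c0 l0 ax.
under eq_integral do rewrite ger0_norm//.
by move/le_trans; apply; rewrite lee_wpmul2l.
Qed.

(* [v] of the large cube is at most |large cube| A v(x) for almost every x in
   the small one: average over x. *)
Lemma A1_doubling a b l m (k : nat) : (0 < l)%R -> (m = k.+1%:R * l)%R ->
  cube a l `<=` cube b m ->
  \int[mu]_(x in cube b m) (v x)%:E <=
  (k.+1%:R ^+ n.+1 * A)%:E * \int[mu]_(x in cube a l) (v x)%:E.
Proof.
move=> l0 mE ab; have m0 : (0 < m)%R by rewrite mE mulr_gt0.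
have [ca ca0 caE] : exists2 ca : R, (0 < ca)%R & mu (cube a l) = ca%:E.
  exists (fine (mu (cube a l))); last by rewrite fineK// leb_cube_fin_num.
  by rewrite fine_gt0// leb_cube_gt0//= -ge0_fin_numE// leb_cube_fin_num.
have cbE : mu (cube b m) = (k.+1%:R ^+ n.+1 * ca)%:E.
  rewrite EFinM -caE /mu (leb_cube b m0) (leb_cube a l0).
  by move: (leb (cube 0 1)) => c; rewrite mE exprMn EFinM muleA.
have cb0 : (0 <= k.+1%:R ^+ n.+1 * ca)%R by rewrite mulr_ge0 ?exprn_ge0// ltW.
have vb x : maximal v x <= (A * v x)%:E -> cube a l x ->
    \int[mu]_(x in cube b m) (v x)%:E <=
    (k.+1%:R ^+ n.+1 * ca * A)%:E * (v x)%:E.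
  move=> vx ax; apply: le_trans (A1_integral_cube_le m0 (ab x ax) vx) _.
  by rewrite cbE -!EFinM lee_fin mulrA.
have : \int[mu]_(x in cube a l) (cst (\int[mu]_(x in cube b m) (v x)%:E) x) <=
    \int[mu]_(x in cube a l) ((k.+1%:R ^+ n.+1 * ca * A)%:E * (v x)%:E).
  have cA : (0 <= k.+1%:R ^+ n.+1 * ca * A)%R by rewrite mulr_ge0// ltW.
  apply: ae_ge0_le_integral.
  - exact: mQ.
  - by move=> x _; exact: integral_ge0.
  - exact: measurable_cst.
  - by move=> x _; rewrite mule_ge0// lee_fin.
  - by apply: measurable_funeM; exact: mvE.
  by apply: filterS hA => x [_ vx] ax; exact: vb.
rewrite integral_cst; last exact: mQ.
rewrite ge0_integralZl; [|exact: mQ|exact: mvE|by move=> x _|]; last first.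
  by rewrite lee_fin mulr_ge0// ltW.
have cancel (I J : \bar R) (K c : R) : (0 < c)%R ->
    I * c%:E <= (K * c * A)%:E * J -> I <= (K * A)%:E * J.
  by move=> c_gt0; rewrite muleC (mulrC K) -mulrA EFinM -muleA lee_pmul2l.
by rewrite [X in _ * X <= _]caE; exact: cancel.
Qed.

(* A nonpositive side gives the empty cube. *)
Let ratcube (k : nat) : 'rV[R]_n.+1 * R :=
  if @unpickle ('rV[rat]_n.+1 * rat)%type k is Some q then
    (map_mx ratr q.1, ratr q.2) else (0, 0)%R.
Let B k : set (Rn R n) := cube (ratcube k).1 (ratcube k).2.
Let B3 k : set (Rn R n) :=
  cube ((ratcube k).1 - const_mx (ratcube k).2)%R (3%:R * (ratcube k).2)%R.
Let rad k := (ratcube k).2.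

Let cube_nonempty a l x : cube a l x -> (0 < l)%R.
Proof. by move=> /(_ ord0); lra. Qed.

Let B3P i j : B i `&` B j !=set0 -> (rad i <= rad j)%R -> B i `<=` B3 j.
Proof.
move=> [x [xi xj]] rij y yi m; rewrite !mxE.
by move: (xi m) (xj m) (yi m) rij; rewrite /rad; lra.
Qed.

Let ratcube_cover a l : (0 < l)%R -> exists k,
  [/\ cube a l `<=` B k, (0 < rad k)%R & (rad k <= 2 * l)%R].
Proof.
move=> l0.
(* The corner is lowered by less than l / 4 in each coordinate, so a side above 3 l / 2 still
   reaches past a + l. *)
have lt1 i : (a ord0 i - l / 4 < a ord0 i)%R by lra.
have lt2 : (3 / 2 * l < 2 * l)%R by lra.
have [b hb] := choice (fun i => rat_in_itvoo (lt1 i)).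
have [m] := rat_in_itvoo lt2; rewrite in_itv/= => /andP[m1 m2].
exists (pickle (\row_i b i, m)%R); rewrite /B /rad /ratcube pickleK /=.
split; [|lra|lra] => x ax i; rewrite !mxE.
by have := hb i; have := ax i; rewrite in_itv/=; lra.
Qed.

Let nuB3 k : \int[mu]_(x in B3 k) (v x)%:E <=
  (3%:R ^+ n.+1 * A)%:E * \int[mu]_(x in B k) (v x)%:E.
Proof.
have [k0|k0] := ltP 0%R (rad k).
  apply: A1_doubling => // x kx i; rewrite !mxE.
  by have := kx i; rewrite /rad in k0; lra.
rewrite (_ : B3 k = set0) ?integral_set0.
  by rewrite mule_ge0 ?integral_ge0// lee_fin mulr_ge0 ?exprn_ge0// ltW.
by apply/seteqP; split=> // x /cube_nonempty; move: k0; rewrite /rad; lra.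
Qed.

(** For x in a cube Q of side l, some rational cube [B k] of side at most 2 l contains Q, and its
    [v]-measure is at most |B k| A v(x), hence at most 2 ^ n.+1 |Q| A v(x). Multiplied by the
    average of |f| / v over [B k], this bounds the integral of |f| over Q. The factor 3 ^ n.+1 A is
    the doubling constant for tripled cubes. *)
Lemma A1_maximal_bound (p : R) (f : Rn R n -> R) : (1 < p)%R ->
  measurable_fun [set: Rn R n] f ->
  exists F : Rn R n -> \bar R,
    [/\ measurable_fun [set: Rn R n] F, forall x, 0 <= F x,
        \forall x \ae mu,
          maximal f x <= (2 ^+ n.+1 * A)%:E * ((v x)%:E * F x) &
        \int[mu]_x (F x `^ p * (v x)%:E) <=
        (strong_constant p (3%:R ^+ n.+1 * A))%:E *
        \int[mu]_x (`|f x| `^ p * v x `^ (1 - p))%:E].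
Proof.
(* The quotient |f| / v, with a power so that measurability follows from that of [powR]; its value
   where [v] vanishes concerns a null set. *)
move=> p1 mf; pose g x := (`|f x| * v x `^ (-1))%R.
have g0 x : (0 <= g x)%R by rewrite mulr_ge0// powR_ge0.
have mvp (r : R) : measurable_fun [set: Rn R n] (fun x => v x `^ r)%R.
  exact: (@measurableT_comp _ _ _ _ _ _ (@powR R ^~ r)).
have mf1 : measurable_fun [set: Rn R n] (fun x => `|f x|)%R.
  exact: measurableT_comp.
have mf1E D : measurable_fun D (fun x => `|f x|%:E).
  by apply/measurable_EFinP;
    exact: measurable_funS measurableT (@subsetT _ _) mf1.
have mg : measurable_fun [set: Rn R n] g by exact: measurable_funM.
have gv x : (0 < v x)%R -> (g x * v x)%R = `|f x|%R.
  by move=> vx; rewrite /g powR_inv1// -mulrA mulVf ?mulr1// gt_eqF.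
have nu_gt0 k x : B k x -> 0 < \int[mu]_(y in B k) (v y)%:E.
  by move=> /cube_nonempty; exact: A1_integral_cube_gt0.
have nu_fin k : \int[mu]_(y in B k) (v y)%:E \is a fin_num.
  by rewrite ge0_fin_numE ?weight_integral_cube_fin// integral_ge0.
have mB k : measurable (B k) by exact: measurable_cube.
have mB3 k : measurable (B3 k) by exact: measurable_cube.
exists (maximal_family mu v B g); split.
- exact: measurable_maximal_family.
- by move=> x; exact: maximal_family_ge0.
- apply: filterS hA => x [vx Mvx];
  apply: ge_ereal_sup => _ [_ [a [l l0 ->]] <-].
  have F0 := maximal_family_ge0 mu v0 B g0 x.
  set F := maximal_family mu v B g x in F0 *.
  have [ax|ax] := pselect (cube a l x); last first.
    rewrite indicE memNset// mule0 mule_ge0 ?mule_ge0// lee_fin mulr_ge0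
      ?exprn_ge0//.
    exact: ltW.
  rewrite indicE mem_set// mule1.
  have [k [ak k0 kl]] := ratcube_cover a l0.
  have [ca ca0 caE] : exists2 ca : R, (0 < ca)%R & mu (cube a l) = ca%:E.
    exists (fine (mu (cube a l))); last by rewrite fineK// leb_cube_fin_num.
    by rewrite fine_gt0// leb_cube_gt0//= -ge0_fin_numE// leb_cube_fin_num.
  rewrite /average [X in X^-1 * _]caE inver gt_eqF// lee_pdivrMl//.
  have : \int[mu]_(y in cube a l) `|f y|%:E <=
      \int[mu]_(y in B k) (g y * v y)%:E.
    have -> : \int[mu]_(y in B k) (g y * v y)%:E =
        \int[mu]_(y in B k) `|f y|%:E.
      apply: ae_eq_integral; [exact: mB| | |].
      - apply/measurable_EFinP.
        exact: measurable_funS measurableT (@subsetT _ _)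
          (measurable_funM mg mv).
      - exact: mf1E.
      - by apply: filterS hA => y [vy _] _; rewrite gv.
    apply: ge0_subset_integral.
    - exact: mQ.
    - exact: mB.
    - exact: mf1E.
    - by move=> y _; rewrite lee_fin.
    - exact: ak.
  move/le_trans; apply.
  have := nu_fin k; have := nu_gt0 k x (ak x ax).
  have : \int[mu]_(y in B k) (v y)%:E <= (2 ^+ n.+1 * ca * (A * v x))%:E.
    apply: le_trans (A1_integral_cube_le k0 (ak x ax) Mvx) _.
    rewrite [leRHS]EFinM lee_wpmul2r//; first by rewrite lee_fin mulr_ge0// ltW.
    rewrite EFinM -caE /mu (leb_cube _ k0) (leb_cube a l0).
    have := ltW c0; move: (leb (cube 0 1)) => c cge0.
    by rewrite muleA -EFinM lee_wpmul2r// lee_fin -exprMn lerXn2r// nnegrE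
      ltW// mulr_gt0.
  have : (\int[mu]_(y in B k) (v y)%:E)^-1 *
      \int[mu]_(y in B k) (g y * v y)%:E <= F.
    apply: ereal_sup_ubound; exists k => //.
    by rewrite indicE mem_set ?mule1//; exact: ak.
  move: (\int[mu]_(y in B k) (g y * v y)%:E) => J.
  case: (\int[mu]_(y in B k) (v y)%:E) => [c|//|//].
  rewrite lte_fin lee_fin => JF cle c_gt0 _.
  move: JF; rewrite inver gt_eqF// lee_pdivrMl// => /le_trans; apply.
  rewrite (muleA _ (v x)%:E) -EFinM muleA -EFinM lee_wpmul2r// lee_fin.
  by apply: le_trans cle _; rewrite le_eqVlt; apply/orP; left; apply/eqP; ring.
- have D0 : (0 <= 3%:R ^+ n.+1 * A)%R by rewrite mulr_ge0 ?exprn_ge0// ltW.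
  have := maximal_family_strong mv v0 mB mB3 B3P D0 nuB3 mg g0 nu_gt0 nu_fin p1.
  move/le_trans; apply.
  rewrite le_eqVlt; apply/orP; left; apply/eqP; congr (_ * _).
  have mpow (h : Rn R n -> R) (t : R) : measurable_fun [set: Rn R n] h ->
      measurable_fun [set: Rn R n] (fun x => h x `^ t)%R.
    exact: (@measurableT_comp _ _ _ _ _ _ (@powR R ^~ t)).
  have m1 := measurable_funM (mpow _ p mg) mv.
  have m2 := measurable_funM (mpow _ p mf1) (mvp (1 - p)%R).
  apply: ae_eq_integral.
  - exact: measurableT.
  - exact/measurable_EFinP/m1.
  - exact/measurable_EFinP/m2.
  - apply: filterS hA => x [vx _] _; congr EFin.
    rewrite /g powRM ?powR_ge0// -powRrM -mulrA; congr (_ * _)%R.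
    rewrite -{2}(powRr1 (ltW vx)) -powRD ?(gt_eqF vx) ?implybT//.
    by congr (_ `^ _)%R; ring.
Qed.

End A1_weights.

(** * Hoelder's inequality with weights *)

Lemma ge0_le_poweR (R : realType) (r : R) (x y : \bar R) :
  (0 <= r)%R -> x <= y -> 0 <= x -> x `^ r <= y `^ r.
Proof.
move=> r0 xy x0; apply: gt0_ler_poweR => //; rewrite in_itv/= leey andbT//.
exact: le_trans xy.
Qed.

(** Adding +oo to [g] on the exceptional null set makes the inequality hold everywhere and leaves
    the integral of [g] unchanged. Used with the maximal function on the left. *)
Lemma ae_ge0_le_integral_nonmeasurable d (T : measurableType d) (R : realType)
    (mu : {measure set T -> \bar R}) (f g : T -> \bar R) :
  (forall x, 0 <= f x) -> (forall x, 0 <= g x) -> measurable_fun [set: T] g ->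
  (\forall x \ae mu, f x <= g x) -> \int[mu]_x f x <= \int[mu]_x g x.
Proof.
move=> f0 g0 mg [N [mN N0 fgN]].
have m1 : measurable_fun [set: T] (fun x => (\1_N x)%:E : \bar R).
  exact/measurable_EFinP/measurable_indic.
apply: (@le_trans _ _ (\int[mu]_x (g x + +oo * (\1_N x)%:E))).
  apply: ge0_le_integral_nonmeasurable => x _ //.
  have [Nx|Nx] := pselect (N x).
    rewrite indicE mem_set// mule1 addey ?leey//.
    by rewrite gt_eqF// (lt_le_trans _ (g0 x)).
  rewrite indicE memNset// mule0 adde0.
  by have [//|fg] := pselect (f x <= g x); exfalso; apply/Nx/fgN.
rewrite ge0_integralD//; last exact: measurable_funeM.
by rewrite ge0_integralZl// integral_indic// setIT N0 mule0 adde0.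
Qed.

(** The counterpart with the maximal function on the right: the null set is removed from the domain
    of the measurable [f]. *)
Lemma ae_ge0_le_integral_measurable_left d (T : measurableType d) (R : realType)
    (mu : {measure set T -> \bar R}) (f g : T -> \bar R) :
  (forall x, 0 <= f x) -> (forall x, 0 <= g x) -> measurable_fun [set: T] f ->
  (\forall x \ae mu, f x <= g x) -> \int[mu]_x f x <= \int[mu]_x g x.
Proof.
move=> f0 g0 mf [N [mN N0 fgN]].
rewrite (ge0_negligible_integral mN measurableT mf _ N0)// setTD
  integral_mkcond.
apply: ge0_le_integral_nonmeasurable => x _; first exact: erestrict_ge0.
rewrite patchE; case: ifPn => //; rewrite inE => Nx.
by have [//|fg] := pselect (f x <= g x); exfalso; apply/Nx/fgN.
Qed.

(** Hoelder's inequality for the q-th powers of Y v ^ (- 1 / p') and u ^ (1 / q) v ^ (1 / p'): the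
    powers of [v] cancel where v > 0, and p / p' = p - 1 produces the weight v ^ (1 - p). *)
Lemma weighted_hoelder d (T : measurableType d) (R : realType)
    (mu : {measure set T -> \bar R}) (p q r p' : R) (u v Y : T -> R) :
  (0 < q)%R -> (q < p)%R -> (1 < p)%R -> (p' = p / (p - 1))%R ->
  (q^-1 = r^-1 + p^-1)%R ->
  measurable_fun [set: T] u -> (forall x, (0 <= u x)%R) ->
  measurable_fun [set: T] v -> (forall x, (0 <= v x)%R) ->
  measurable_fun [set: T] Y -> (forall x, (0 <= Y x)%R) ->
  (\forall x \ae mu, (0 < v x)%R) ->
  (\int[mu]_x (Y x `^ q * u x)%:E) `^ q^-1 <=
  (\int[mu]_x (Y x `^ p * v x `^ (1 - p))%:E) `^ p^-1 *
  Lnorm mu r%:E (fun x => (u x `^ q^-1 * v x `^ p'^-1)%:E).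
Proof.
move=> q0 qp p1 p'E rE mu_ u0 mv v0 mY Y0 vpos.
have p0 : (0 < p)%R by lra.
have r0 : (0 < r)%R.
  by rewrite -invr_gt0 (_ : r^-1 = q^-1 - p^-1)%R;
    [rewrite subr_gt0 ltf_pV2|lra].
have p'V : (p'^-1 = (p - 1) / p)%R by rewrite p'E invf_div.
have mpow (h : T -> R) s : measurable_fun [set: T] h ->
    measurable_fun [set: T] (fun x => h x `^ s)%R.
  exact: (@measurableT_comp _ _ _ _ _ _ (@powR R ^~ s)).
pose a x := ((Y x * v x `^ (- p'^-1)) `^ q)%R.
pose b x := ((u x `^ q^-1 * v x `^ p'^-1) `^ q)%R.
have ma : measurable_fun [set: T] a
  by apply/mpow/measurable_funM => //; exact: mpow.
have mb : measurable_fun [set: T] b by apply/mpow/measurable_funM; exact: mpow.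
have s0 : (0 < p / q)%R by rewrite divr_gt0.
have s'0 : (0 < r / q)%R by rewrite divr_gt0.
have ss' : ((p / q)^-1 + (r / q)^-1 = 1)%R.
  by rewrite !invf_div -mulrDr addrC -rE divff// gt_eqF.
have := hoelder mu ma mb s0 s'0 ss'.
have -> : Lnorm mu 1 (EFin \o (a \* b)%R) = \int[mu]_x (Y x `^ q * u x)%:E.
  rewrite Lnorm1; apply: ae_eq_integral => //.
  - by apply: measurableT_comp => //; apply/measurable_EFinP/measurable_funM.
  - by apply/measurable_EFinP/measurable_funM => //; exact: mpow.
  apply: filterS vpos => x vx _ /=.
  rewrite ger0_norm ?mulr_ge0 ?powR_ge0//; congr EFin.
  rewrite /a /b -powRM ?mulr_ge0 ?powR_ge0//.
  have -> : (Y x * v x `^ (- p'^-1) * (u x `^ q^-1 * v x `^ p'^-1) =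
      Y x * u x `^ q^-1)%R.
    by rewrite powRN; field; rewrite gt_eqF ?powR_gt0.
  by rewrite powRM ?powR_ge0// -powRrM mulVf ?gt_eqF// powRr1.
have q'0 : (0 <= q^-1)%R by rewrite invr_ge0 ltW.
move=> /(ge0_le_poweR q'0) h.
apply: le_trans (h _) _; first
  by apply: integral_ge0 => x _; rewrite lee_fin mulr_ge0 ?powR_ge0.
rewrite poweRM ?Lnorm_ge0// le_eqVlt; apply/orP; left; apply/eqP; congr (_ * _).
  rewrite unlock -poweRrM invf_div (_ : q / p * q^-1 = p^-1)%R; last first.
    by field; rewrite !gt_eqF.
  congr (_ `^ _); apply: eq_integral => x _ /=.
  rewrite ger0_norm ?powR_ge0// /a -powRrM (_ : q * (p / q) = p)%R; last first.
    by field; rewrite gt_eqF.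
  rewrite powRM ?powR_ge0// -powRrM; congr (_ * _ `^ _)%:E.
  by rewrite p'V; field; rewrite gt_eqF.
rewrite unlock -poweRrM invf_div (_ : q / r * q^-1 = r^-1)%R; last first.
  by field; rewrite !gt_eqF.
apply: (congr1 (fun z => z `^ r^-1)); apply: eq_integral => x _ /=.
rewrite !ger0_norm ?mulr_ge0 ?powR_ge0// /b -powRrM.
by congr (_ `^ _)%:E; field; rewrite gt_eqF.
Qed.

Lemma weighted_hoelder_majorant d (T : measurableType d) (R : realType)
    (mu : {measure set T -> \bar R}) (p q r p' K1 K2 : R) (u v : T -> R)
    (M F : T -> \bar R) (J : \bar R) :
  (0 < q)%R -> (q < p)%R -> (1 < p)%R -> (p' = p / (p - 1))%R ->
  (q^-1 = r^-1 + p^-1)%R -> (0 <= K1)%R -> (0 <= K2)%R ->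
  measurable_fun [set: T] u -> (forall x, (0 <= u x)%R) ->
  measurable_fun [set: T] v -> (forall x, (0 <= v x)%R) ->
  measurable_fun [set: T] F -> (forall x, 0 <= F x) -> (forall x, 0 <= M x) ->
  (\forall x \ae mu, (0 < v x)%R) ->
  (\forall x \ae mu, M x <= K1%:E * ((v x)%:E * F x)) ->
  \int[mu]_x (F x `^ p * (v x)%:E) <= K2%:E * J -> 0 <= J -> J < +oo ->
  (\int[mu]_x (`|M x| `^ q * (u x)%:E)) `^ q^-1 <=
  (K1 * K2 `^ p^-1)%:E * J `^ p^-1 *
  Lnorm mu r%:E (fun x => (u x `^ q^-1 * v x `^ p'^-1)%:E).
Proof.
move=> q0 qp p1 p'E rE K10 K20 mu_ u0 mv v0 mF F0 M0 vpos MF FJ J0 Joo.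
have p0 : (0 < p)%R by lra.
have mpow (h : T -> R) s : measurable_fun [set: T] h ->
    measurable_fun [set: T] (fun x => h x `^ s)%R.
  exact: (@measurableT_comp _ _ _ _ _ _ (@powR R ^~ s)).
have mFp : measurable_fun [set: T] (fun x => F x `^ p * (v x)%:E).
  apply: emeasurable_funM; last exact/measurable_EFinP.
  exact: (measurableT_comp (measurable_poweR _) mF).
have Fp0 x : 0 <= F x `^ p * (v x)%:E by rewrite mule_ge0 ?poweR_ge0 ?lee_fin.
(* F ^ p v is integrable and v > 0 almost everywhere, so the majorant can be replaced by the
   real-valued [Y]. *)
have Ffin : \forall x \ae mu, F x \is a fin_num.
  have : mu.-integrable [set: T] (fun x => F x `^ p * (v x)%:E).
    apply/integrableP; split=> //.
    under eq_integral do rewrite gee0_abs//.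
    by apply: le_lt_trans FJ _; rewrite lte_mul_pinfty// lee_fin.
  move/(integrable_ae measurableT) => Fv.
  apply: filterS2 vpos Fv => x vx /(_ I).
  have := F0 x; case: (F x) => // _.
  by rewrite poweRyr ?gt_eqF// gt0_mulye.
have mX : measurable_fun [set: T] (fun x => fine (F x)).
  exact: measurableT_comp.
pose Y x := (K1 * (v x * fine (F x)))%R.
have Y0 x : (0 <= Y x)%R.
  by apply: mulr_ge0 => //; apply: mulr_ge0 => //; exact: fine_ge0.
have mY : measurable_fun [set: T] Y.
  exact: measurable_funM (measurable_cst _) (measurable_funM mv mX).
have MY : \int[mu]_x (`|M x| `^ q * (u x)%:E) <=
    \int[mu]_x (Y x `^ q * u x)%:E.
  apply: ae_ge0_le_integral_nonmeasurable.
  - by move=> x; rewrite mule_ge0 ?poweR_ge0 ?lee_fin.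
  - by move=> x; rewrite lee_fin mulr_ge0 ?powR_ge0.
  - by apply/measurable_EFinP/measurable_funM => //; exact: mpow.
  apply: filterS2 MF Ffin => x Mx Fx.
  rewrite gee0_abs// EFinM lee_wpmul2r ?lee_fin// -poweR_EFin.
  apply: ge0_le_poweR (ltW q0) _ (M0 _).
  by move: Mx; rewrite -[in X in X -> _](fineK Fx) -!EFinM.
apply: (@le_trans _ _ ((\int[mu]_x (Y x `^ q * u x)%:E) `^ q^-1)).
  apply: ge0_le_poweR MY _; first by rewrite invr_ge0 ltW.
  by apply: integral_ge0 => x _; rewrite mule_ge0 ?poweR_ge0 ?lee_fin.
apply: le_trans (weighted_hoelder q0 qp p1 p'E rE mu_ u0 mv v0 mY Y0 vpos) _.
rewrite lee_wpmul2r ?Lnorm_ge0//.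
(* Because (v F) ^ p v ^ (1 - p) = F ^ p v. *)
have YJ : \int[mu]_x (Y x `^ p * v x `^ (1 - p))%:E <= (K1 `^ p * K2)%:E * J.
  rewrite EFinM -muleA; apply: le_trans (lee_wpmul2l _ FJ); last first.
    by rewrite lee_fin powR_ge0.
  rewrite -ge0_integralZl//; last by rewrite lee_fin powR_ge0.
  apply: ae_ge0_le_integral => //.
  - by move=> x _; rewrite lee_fin mulr_ge0 ?powR_ge0.
  - by apply/measurable_EFinP/measurable_funM; exact: mpow.
  - by move=> x _; rewrite mule_ge0// lee_fin powR_ge0.
  - exact: measurable_funeM.
  apply: filterS2 vpos Ffin => x vx Fx _.
  rewrite -[in leRHS](fineK Fx) poweR_EFin -!EFinM lee_fin.
  rewrite /Y !powRM// ?mulr_ge0 ?fine_ge0// -!mulrA ler_wpM2l ?powR_ge0//.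
  rewrite mulrCA ler_wpM2l ?powR_ge0// -powRD ?(gt_eqF vx) ?implybT//.
  by rewrite addrC subrK powRr1.
apply: (@le_trans _ _ (((K1 `^ p * K2)%:E * J) `^ p^-1)).
  apply: ge0_le_poweR YJ _; first by rewrite invr_ge0 ltW.
  by apply: integral_ge0 => x _; rewrite lee_fin mulr_ge0 ?powR_ge0.
rewrite poweRM//; last by rewrite lee_fin mulr_ge0 ?powR_ge0.
rewrite poweR_EFin powRM ?powR_ge0// -powRrM mulfV ?gt_eqF// powRr1//.
Qed.

(** Let I be the integral of [W], the r-th power of the function in the [Lnorm], over [S k]. Testing
    the bound on [h] cut off to [S k] gives I ^ (1 / q) <= C I ^ (1 / p), hence I ^ (1 / r) <= C,
    uniformly in k. *)
Lemma weighted_hoelder_converse d (T : measurableType d) (R : realType)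
    (mu : {measure set T -> \bar R}) (p q r p' C : R) (u v : T -> R)
    (E : nat -> set T) :
  (0 < q)%R -> (q < p)%R -> (1 < p)%R -> (p' = p / (p - 1))%R ->
  (q^-1 = r^-1 + p^-1)%R -> (0 <= C)%R ->
  measurable_fun [set: T] u -> (forall x, (0 <= u x)%R) ->
  measurable_fun [set: T] v -> (forall x, (0 <= v x)%R) ->
  (forall k, measurable (E k)) -> nondecreasing_seq E -> \bigcup_k E k = setT ->
  (forall k, mu (E k) < +oo) ->
  (forall f : T -> R, measurable_fun [set: T] f -> (forall x, (0 <= f x)%R) ->
    \int[mu]_x (f x `^ p * v x `^ (1 - p))%:E < +oo ->
    (\int[mu]_x (f x `^ q * u x)%:E) `^ q^-1 <=
    C%:E * (\int[mu]_x (f x `^ p * v x `^ (1 - p))%:E) `^ p^-1) ->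
  Lnorm mu r%:E (fun x => (u x `^ q^-1 * v x `^ p'^-1)%:E) < +oo.
Proof.
move=> q0 qp p1 p'E rE C0 mu_ u0 mv v0 mE ndE UE Efin bound.
have p0 : (0 < p)%R by lra.
have r0 : (0 < r)%R.
  by rewrite -invr_gt0 (_ : r^-1 = q^-1 - p^-1)%R;
    [rewrite subr_gt0 ltf_pV2|lra].
have pq0 : (0 < p - q)%R by lra.
have rV : (r = p * q / (p - q))%R.
  apply: invr_inj; rewrite (_ : r^-1 = q^-1 - p^-1)%R; last by lra.
  by field; rewrite !gt_eqF.
have p'V : (p'^-1 = (p - 1) / p)%R by rewrite p'E invf_div.
have mpow (h : T -> R) s : measurable_fun [set: T] h ->
    measurable_fun [set: T] (fun x => h x `^ s)%R.
  exact: (@measurableT_comp _ _ _ _ _ _ (@powR R ^~ s)).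
pose W x := ((u x `^ q^-1 * v x `^ p'^-1) `^ r)%R.
have W0 x : (0 <= W x)%R by exact: powR_ge0.
have mW : measurable_fun [set: T] W.
  by apply/mpow/measurable_funM; exact: mpow.
(* The equality case of Hoelder: [h ^ q u = h ^ p v ^ (1 - p) = W]. *)
pose h x := ((u x * v x `^ (p - 1)) `^ (p - q)^-1)%R.
have h0 x : (0 <= h x)%R by exact: powR_ge0.
have mh : measurable_fun [set: T] h.
  by apply/mpow/measurable_funM => //; exact: mpow.
have WE x : W x = (u x `^ (p / (p - q)) * v x `^ ((p - 1) * q / (p - q)))%R.
  rewrite /W powRM ?powR_ge0// -!powRrM rV p'V.
  by congr (_ `^ _ * _ `^ _)%R; field; rewrite !gt_eqF.
have hq x : (h x `^ q * u x)%R = W x.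
  rewrite WE /h -powRrM powRM ?powR_ge0// -powRrM mulrAC; congr (_ * _)%R.
    rewrite -[X in (_ * X)%R](powRr1 (u0 x)) -powRD; last first.
      by rewrite gt_eqF// addr_gt0// mulr_gt0// invr_gt0.
    by congr (_ `^ _)%R; field; rewrite gt_eqF.
  by congr (_ `^ _)%R; field; rewrite gt_eqF.
have hp x : (h x `^ p * v x `^ (1 - p))%R = W x.
  rewrite WE /h -powRrM powRM ?powR_ge0// -powRrM -mulrA; congr (_ * _)%R.
    by congr (_ `^ _)%R; field; rewrite gt_eqF.
  (* The total exponent is nonzero, so the powers of [v x] may be added even where [v x = 0]. *)
  have e : ((p - 1) * ((p - q)^-1 * p) + (1 - p) = (p - 1) * q / (p - q))%R.
    by field; rewrite gt_eqF.
  by rewrite -powRD e// gt_eqF// divr_gt0// mulr_gt0// subr_gt0.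
(* [W] is bounded on [S k], which has finite measure. Its integral is thus finite, as the test and
   the division by a power of it require. *)
pose S k := E k `&` [set x | (u x <= k%:R)%R] `&` [set x | (v x <= k%:R)%R].
have mle (w : T -> R) (t : R) : measurable_fun [set: T] w ->
    measurable [set x | (w x <= t)%R].
  move=> /measurable_EFinP mw.
  by have := emeasurable_fun_infty_c measurableT mw t%:E; rewrite setTI.
have mS k : measurable (S k).
  by apply: measurableI; [apply: measurableI|] => //; exact: mle.
have ndS : nondecreasing_seq S.
  move=> i j ij; apply/subsetPset => x [[Ex ux] vx].
  have ijR : (i%:R <= j%:R :> R)%R by rewrite ler_nat.
  split; [split|]; [|exact: le_trans ijR..].
  by have /subsetPset := ndE _ _ ij; apply.
have US : \bigcup_k S k = setT.
  apply/seteqP; split=> // x _.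
  have [i _ Ex] : (\bigcup_k E k) x by rewrite UE.
  pose a := Num.truncn (u x); pose b := Num.truncn (v x).
  pose k := (i + a.+1 + b.+1)%N; exists k => //; split; first split.
  - by have /subsetPset := ndE i k (leq_trans (leq_addr _ _) (leq_addr _ _));
    apply.
  - rewrite /= ltW// (lt_le_trans (truncnS_gt _))// ler_nat.
    exact: leq_trans (leq_addl i _) (leq_addr _ _).
  - rewrite /= ltW// (lt_le_trans (truncnS_gt _))// ler_nat.
    exact: leq_addl.
have WS k : \int[mu]_(x in S k) (W x)%:E <= (C `^ r)%:E.
  pose f x := (h x * \1_(S k) x)%R.
  have mf : measurable_fun [set: T] f.
    by apply: measurable_funM => //; exact: measurable_indic.
  have f0 x : (0 <= f x)%R by apply: (mulr_ge0 (h0 x)); rewrite indicE ler0n.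
  have fE (s t : R) (w : T -> R) : (s != 0)%R ->
      (forall x, h x `^ s * w x = W x)%R ->
      \int[mu]_x (f x `^ s * w x)%:E = \int[mu]_(x in S k) (W x)%:E.
    move=> s0 hs; rewrite [RHS]integral_mkcond; apply: eq_integral => x _.
    rewrite patchE /f indicE; case: ifPn => _ /=; first by rewrite mulr1 hs.
    by rewrite mulr0 powR0// mul0r.
  have mWS : measurable_fun (S k) (fun x => (W x)%:E).
    by apply/measurable_EFinP;
      exact: measurable_funS measurableT (@subsetT _ _) mW.
  have Wfin : \int[mu]_(x in S k) (W x)%:E < +oo.
    pose m := (k%:R `^ (p / (p - q)) * k%:R `^ ((p - 1) * q / (p - q)) : R)%R.
    apply: (@le_lt_trans _ _ (\int[mu]_(x in S k) (cst m%:E) x)).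
      apply: ge0_le_integral => //; first by move=> x _; rewrite lee_fin.
      move=> x [[_ /= ux] vx]; rewrite lee_fin WE /m.
      rewrite ler_pM ?powR_ge0// ge0_ler_powR ?nnegrE//.
        by rewrite divr_ge0 ?(ltW p0) ?(ltW pq0).
      by rewrite divr_ge0 ?(ltW pq0)// mulr_ge0 ?(ltW q0)// subr_ge0 ltW.
    rewrite integral_cst// lte_mul_pinfty ?lee_fin ?mulr_ge0 ?powR_ge0//.
    apply: le_lt_trans (Efin k); apply: le_measure; rewrite ?inE//.
    by move=> x [[]].
  have := bound f mf f0; rewrite (fE q) ?(fE p) ?gt_eqF// => /(_ Wfin).
  have : 0 <= \int[mu]_(x in S k) (W x)%:E.
    by apply: integral_ge0 => x _; rewrite lee_fin.
  move: Wfin; case: (\int[mu]_(x in S k) (W x)%:E) => [i _|//|//].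
  rewrite !poweR_EFin -EFinM !lee_fin le_eqVlt => /predU1P[<-|i0].
    by rewrite powR_ge0.
  rewrite rE powRD ?(gt_eqF i0) ?implybT// ler_pM2r ?powR_gt0// => iC.
  rewrite -[leLHS](powRr1 (ltW i0)) -(mulVf (lt0r_neq0 r0)) powRrM.
  by rewrite ge0_ler_powR ?nnegrE ?powR_ge0// ltW.
have cvgS : \int[mu]_(x in S k) (W x)%:E @[k --> \oo] -->
    \int[mu]_(x in \bigcup_k S k) (W x)%:E.
  apply: ge0_nondecreasing_set_cvg_integral => //.
    by move=> k; apply/measurable_EFinP;
      exact: measurable_funS measurableT (@subsetT _ _) mW.
  by move=> k x _; rewrite lee_fin.
have WT : \int[mu]_x (W x)%:E <= (C `^ r)%:E.
  rewrite -US -(cvg_lim _ cvgS)//; apply: lime_le; first by apply/cvgP: cvgS.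
  exact: nearW.
rewrite unlock poweR_lty//; apply: le_lt_trans (ltry (C `^ r)%R).
apply: le_trans WT; rewrite le_eqVlt; apply/orP; left; apply/eqP.
apply: eq_integral => x _; rewrite gee0_abs ?lee_fin ?mulr_ge0 ?powR_ge0//.
Qed.

(** The constant is moved to the side of the measurable [f], where it can be taken through the
    integral; [M] stands for the maximal function. *)
Lemma weighted_integral_le_majorant d (T : measurableType d) (R : realType)
    (mu : {measure set T -> \bar R}) (q c : R) (u f : T -> R)
    (M : T -> \bar R) :
  (0 < q)%R -> (0 < c)%R ->
  measurable_fun [set: T] u -> (forall x, (0 <= u x)%R) ->
  measurable_fun [set: T] f -> (forall x, (0 <= f x)%R) ->
  (forall x, 0 <= M x) -> (\forall x \ae mu, (f x)%:E <= c%:E * M x) ->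
  (\int[mu]_x (f x `^ q * u x)%:E) `^ q^-1 <=
  c%:E * (\int[mu]_x (`|M x| `^ q * (u x)%:E)) `^ q^-1.
Proof.
move=> q0 c0 mesu u0 mf f0 M0 fM.
have mpow (h : T -> R) s : measurable_fun [set: T] h ->
    measurable_fun [set: T] (fun x => h x `^ s)%R.
  exact: (@measurableT_comp _ _ _ _ _ _ (@powR R ^~ s)).
have q'0 : (0 <= q^-1)%R by rewrite invr_ge0 ltW.
have c'0 : (0 <= c^-1)%R by rewrite invr_ge0 ltW.
rewrite -lee_pdivrMl//.
have -> : (c^-1)%:E * (\int[mu]_x (f x `^ q * u x)%:E) `^ q^-1 =
    (\int[mu]_x ((c^-1 * f x) `^ q * u x)%:E) `^ q^-1.
  have -> : \int[mu]_x ((c^-1 * f x) `^ q * u x)%:E =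
      (c^-1 `^ q)%:E * \int[mu]_x (f x `^ q * u x)%:E.
    rewrite -ge0_integralZl_EFin ?powR_ge0//; last 2 first.
    - by move=> x _; rewrite lee_fin mulr_ge0 ?powR_ge0.
    - by apply/measurable_EFinP/measurable_funM => //; exact: mpow.
    apply: eq_integral => x _; rewrite powRM// -EFinM.
    by rewrite -mulrA.
  rewrite poweRM ?lee_fin ?powR_ge0//; last first.
    by apply: integral_ge0 => x _; rewrite lee_fin mulr_ge0 ?powR_ge0.
  by rewrite poweR_EFin -powRrM mulfV ?gt_eqF// powRr1.
apply: ge0_le_poweR q'0 _ _; last first.
  by apply: integral_ge0 => x _; rewrite lee_fin mulr_ge0 ?powR_ge0.
apply: ae_ge0_le_integral_measurable_left.
- by move=> x; rewrite lee_fin mulr_ge0 ?powR_ge0.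
- by move=> x; rewrite mule_ge0 ?poweR_ge0 ?lee_fin.
- apply/measurable_EFinP/measurable_funM => //; apply/mpow.
  exact: measurable_funM.
apply: filterS fM => x; rewrite -lee_pdivrMl// -EFinM => fM.
rewrite EFinM lee_wpmul2r ?lee_fin// -poweR_EFin gee0_abs//.
by apply: ge0_le_poweR (ltW q0) fM _; rewrite lee_fin mulr_ge0.
Qed.

(** * The two-weight inequality *)

Section two_weight.
Context (R : realType) (n : nat) (p q r p' : R) (u v : Rn R n -> R).
Hypotheses (q0 : (0 < q)%R) (qp : (q < p)%R) (p1 : (1 < p)%R).
Hypotheses (p'E : (p' = p / (p - 1))%R) (rE : (q^-1 = r^-1 + p^-1)%R).
Hypotheses (wu : weight u) (wv : weight v).
Local Notation mu := (@leb R n).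
Let p0 : (0 < p)%R := lt_trans ltr01 p1.
Let mesu : measurable_fun [set: Rn R n] u. Proof. by case: wu. Qed.
Let mesv : measurable_fun [set: Rn R n] v. Proof. by case: wv. Qed.
Let u0 x : (0 <= u x)%R. Proof. by case: wu => _ + _ _; exact. Qed.
Let v0 x : (0 <= v x)%R. Proof. by case: wv => _ + _ _; exact. Qed.
Let mpow (h : Rn R n -> R) s : measurable_fun [set: Rn R n] h ->
  measurable_fun [set: Rn R n] (fun x => h x `^ s)%R.
Proof. exact: (@measurableT_comp _ _ _ _ _ _ (@powR R ^~ s)). Qed.

Lemma wnormE (s : R) (w f : Rn R n -> R) :
  wnorm s w (EFin \o f) = (\int[mu]_x (`|f x| `^ s * w x)%:E) `^ s^-1.
Proof. by []. Qed.

Lemma maximal_bound_of_Lnorm : A1_constant v < +oo ->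
  Lnorm mu r%:E (fun x => (u x `^ q^-1 * v x `^ p'^-1)%:E) < +oo ->
  exists2 C : R, (0 < C)%R &
    forall f : Rn R n -> R, wLspace p (fun x => (v x `^ (1 - p))%R) f ->
      wnorm q u (maximal f) <=
      C%:E * wnorm p (fun x => (v x `^ (1 - p))%R) (EFin \o f).
Proof.
move=> /(A1_ae wv)[A A0 hA]; set L := Lnorm _ _ _ => Loo.
have L0 : 0 <= L by exact: Lnorm_ge0.
have Lfin : L \is a fin_num by rewrite ge0_fin_numE.
set K1 := (2 ^+ n.+1 * A)%R; set K2 := strong_constant p (3%:R ^+ n.+1 * A).
have K10 : (0 <= K1)%R by rewrite mulr_ge0 ?exprn_ge0// ltW.
have K20 : (0 <= K2)%R
  by rewrite strong_constant_ge0// mulr_ge0 ?exprn_ge0// ltW.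
have C0 : (0 <= K1 * K2 `^ p^-1 * fine L)%R.
  by apply: mulr_ge0 (fine_ge0 L0); rewrite mulr_ge0// powR_ge0.
(* The summand 1 makes the constant positive, the product being known only to be nonnegative. *)
exists (K1 * K2 `^ p^-1 * fine L + 1)%R; first by rewrite ltr_wpDl.
move=> f [mf]; rewrite wnormE => /lty_poweRy.
rewrite invr_eq0 gt_eqF// => /(_ isT); set J := \int[mu]_x _ => Joo.
have J0 : 0 <= J by apply: integral_ge0 => x _;
  rewrite lee_fin mulr_ge0 ?powR_ge0.
have [F [mF F0 MfF FI]] := A1_maximal_bound wv A0 hA p1 mf.
have vpos : \forall x \ae mu, (0 < v x)%R by apply: filterS hA => x [].
have := weighted_hoelder_majorant q0 qp p1 p'E rE K10 K20 mesu u0 mesv v0 mF F0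
  (maximal_ge0 f) vpos MfF FI J0 Joo.
move/le_trans; apply; rewrite -/L -(fineK Lfin) muleAC -EFinM lee_wpmul2r
  ?poweR_ge0//.
by rewrite lee_fin lerDl.
Qed.

Lemma Lnorm_lty_of_maximal_bound :
  (exists2 C : R, (0 < C)%R &
    forall f : Rn R n -> R, wLspace p (fun x => (v x `^ (1 - p))%R) f ->
      wnorm q u (maximal f) <=
      C%:E * wnorm p (fun x => (v x `^ (1 - p))%R) (EFin \o f)) ->
  Lnorm mu r%:E (fun x => (u x `^ q^-1 * v x `^ p'^-1)%:E) < +oo.
Proof.
move=> [C C0 bound]; have c0 := weight_cube_unit_gt0 wv.
pose c : R := (2 * 4 ^+ n.+1)%R.
have cgt0 : (0 < c)%R by rewrite mulr_gt0// exprn_gt0.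
have q'0 : (0 <= q^-1)%R by rewrite invr_ge0 ltW.
apply: (@weighted_hoelder_converse _ _ _ mu p q r p' (c * C) u v
  (centered_cube R n)
  q0 qp p1 p'E rE _ mesu u0 mesv v0).
- exact: mulr_ge0 (ltW cgt0) (ltW C0).
- by move=> k; exact: measurable_cube.
- by move=> i j ij; apply/subsetPset; exact: centered_cube_sub.
- exact: bigcup_centered_cube.
- move=> k; apply: le_lt_trans (leb_cube_le _ _) _; last by rewrite ltry.
  by rewrite mulr_gt0.
move=> f mf f0; set J := \int[mu]_x _ => Joo.
have wJ : wnorm p (fun x => (v x `^ (1 - p))%R) (EFin \o f) = J `^ p^-1.
  rewrite wnormE; apply: (congr1 (fun z => z `^ p^-1)).
  by apply: eq_integral => x _; rewrite ger0_norm.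
have fM : \forall x \ae mu, (f x)%:E <= c%:E * maximal f x.
  by apply: filterS (ae_le_maximal mf c0) => x; rewrite ger0_norm.
have fL : wLspace p (fun x => (v x `^ (1 - p))%R) f.
  by split; [exact: mf|rewrite wJ; exact: poweR_lty].
have := weighted_integral_le_majorant q0 cgt0 mesu u0 mf f0 (maximal_ge0 f) fM.
move/le_trans; apply; rewrite (EFinM c) -muleA; apply: lee_wpmul2l.
  by rewrite lee_fin ltW.
by have := bound f fL; rewrite wJ.
Qed.

End two_weight.

(* In v x `^ (1 - p), the convention 0 `^ (1 - p) = 0 of powR is immaterial:
   an A_1 weight is positive almost everywhere. *)
Theorem proposition5p1 (R : realType) (n : nat) (p q r p' : R)
    (u v : Rn R n -> R)
    (hq : (0 < q)%R) (hqp : (q < p)%R) (hp : (1 < p)%R)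
    (hp' : p' = (p / (p - 1))%R)
    (hr : (q^-1 = r^-1 + p^-1)%R)
    (hu : weight u) (hv : weight v) (hA1 : A1 v) :
  (exists2 C : R, (0 < C)%R &
     forall f : Rn R n -> R, wLspace p (fun x => (v x `^ (1 - p))%R) f ->
       wnorm q u (maximal f) <=
       C%:E * wnorm p (fun x => (v x `^ (1 - p))%R) (EFin \o f))
  <->
  Lnorm (@leb R n) r%:E (fun x => (u x `^ q^-1 * v x `^ p'^-1)%:E) < +oo.
Proof.
split; first exact: Lnorm_lty_of_maximal_bound hq hqp hp hp' hr hu hv.
exact: maximal_bound_of_Lnorm hq hqp hp hp' hr hu hv (proj2 hA1).
Qed.
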